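(* Let $k$ be a field of characteristic $0$ and let $\Theta$ be the variety of all alternative linear algebras over $k$. Let $\mathfrak{A}$ be the group of all automorphisms of the category $\Theta^0$ of finitely generated free algebras of $\Theta$, and let $\mathfrak{Y}$ be the normal subgroup of all inner automorphisms. Then $$\mathfrak{A}/\mathfrak{Y}\;\cong\; \mathbf{S}_2\times \mathrm{Aut}\,k ,$$ where $\mathbf{S}_2$ is the symmetric group on two elements and $\mathrm{Aut}\,k$ is the group of all field automorphisms of $k$.
   Context: A linear algebra over $k$ is a $k$-vector space with a $k$-bilinear multiplication (not assumed associative, commutative or unital). It is regarded as a one-sorted universal algebra with operations $0$, $+$, $\cdot$, and one unary operation $h\mapsto\lambda h$ for each $\lambda\in k$; homomorphisms are $k$-linear multiplicative maps. A linear algebra is alternative if it satisfies $(x_1x_1)x_2=x_1(x_1x_2)$ and $x_2(x_1x_1)=(x_2x_1)x_1$. Fix a countable set $X_0=\{x_1,x_2,\ldots\}$. The category $\Theta^0$ has as objects the free algebras $F(X)$ of $\Theta$ generated by finite subsets $X\subset X_0$, and as morphisms all homomorphisms between them. An automorphism of a category $\mathfrak{K}$ is an invertible functor $\mathfrak{K}\to\mathfrak{K}$; an automorphism $\Upsilon$ is inner if it is isomorphic as a functor to the identity functor, i.e. for each object $A$ there is an isomorphism $s_A:A\to\Upsilon(A)$ with $\Upsilon(\psi)s_A=s_B\psi$ for every morphism $\psi:A\to B$. *)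

(* Defs.v *)
From HB Require Import structures.
From mathcomp Require Import all_boot all_algebra perm.
From mathcomp Require Import finmap boolp.

Set Implicit Arguments.
Unset Strict Implicit.
Unset Printing Implicit Defensive.

Import GRing.Theory.
Local Open Scope ring_scope.
Local Open Scope quotient_scope.

Record normalSubgroup (G : groupType) := NormalSubgroup {
  nsg_set :> G -> Prop;
  nsg1 : nsg_set 1%g;
  nsgM : forall x y, nsg_set x -> nsg_set y -> nsg_set (x * y)%g;
  nsgV : forall x, nsg_set x -> nsg_set x^-1%g;
  nsgJ : forall x y, nsg_set x -> nsg_set (x ^ y)%g
}.

Section QuotientGroup.
Variables (G : groupType) (N : normalSubgroup G).
Local Open Scope group_scope.

Definition coset_rel : rel G := fun x y => `[< N (x^-1 * y) >].

Lemma coset_rel_refl : reflexive coset_rel.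
Proof. by move=> x; apply/asboolP; rewrite mulVg; exact: nsg1. Qed.

Lemma coset_rel_sym : symmetric coset_rel.
Proof.
have aux x y : coset_rel x y -> coset_rel y x.
  by move/asboolP/(nsgV (n := N)) => h; apply/asboolP; rewrite invgM invgK in h.
by move=> x y; apply/idP/idP; exact: aux.
Qed.

Lemma coset_rel_trans : transitive coset_rel.
Proof.
move=> y x z /asboolP h1 /asboolP h2; apply/asboolP.
by have := nsgM h1 h2; rewrite -mulgA mulVKg.
Qed.

Canonical coset_equiv_rel :=
  EquivRel coset_rel coset_rel_refl coset_rel_sym coset_rel_trans.

Definition quotientGroup := {eq_quot coset_equiv_rel}.

HB.instance Definition _ : EqQuotient _ coset_equiv_rel quotientGroup :=
  EqQuotient.on quotientGroup.
HB.instance Definition _ := Choice.on quotientGroup.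

Lemma eq_coset (x y : G) :
  \pi_quotientGroup x = \pi_quotientGroup y <-> N (x^-1 * y).
Proof.
split=> [/eqmodP/asboolP //|h]; apply/eqmodP; exact/asboolP.
Qed.

Lemma repr_coset (x : G) : N (x^-1 * repr (\pi_quotientGroup x)).
Proof. by apply/eq_coset; rewrite reprK. Qed.

Definition quo_one : quotientGroup := \pi_quotientGroup 1.
Definition quo_mul (a b : quotientGroup) : quotientGroup :=
  \pi_quotientGroup (repr a * repr b).
Definition quo_inv (a : quotientGroup) : quotientGroup :=
  \pi_quotientGroup (repr a)^-1.

Lemma quo_mulE (x y : G) :
  quo_mul (\pi_quotientGroup x) (\pi_quotientGroup y)
  = \pi_quotientGroup (x * y).
Proof.
apply/esym/eq_coset; rewrite invgM.
set x' := repr _; set y' := repr _.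
have -> : y^-1 * x^-1 * (x' * y') = (x^-1 * x') ^ y * (y^-1 * y').
  by rewrite /conjg !mulgA mulgK.
apply: nsgM; last exact: repr_coset.
by apply: nsgJ; exact: repr_coset.
Qed.

Lemma quo_invE (x : G) : quo_inv (\pi_quotientGroup x)
  = \pi_quotientGroup x^-1.
Proof.
apply/esym/eq_coset; rewrite invgK.
set x' := repr _.
have -> : x * x'^-1 = ((x^-1 * x')^-1) ^ x^-1.
  by rewrite /conjg invgM !invgK mulgK.
by apply: nsgJ; apply: nsgV; exact: repr_coset.
Qed.

Lemma quo_mulA : associative quo_mul.
Proof.
elim/quotW=> a; elim/quotW=> b; elim/quotW=> c.
by rewrite (quo_mulE b c) (quo_mulE a b) !quo_mulE mulgA.
Qed.

Lemma quo_mul1 : left_id quo_one quo_mul.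
Proof. by move=> a; rewrite -[a]reprK quo_mulE mul1g. Qed.

Lemma quo_mulr1 : right_id quo_one quo_mul.
Proof. by move=> a; rewrite -[a]reprK quo_mulE mulg1. Qed.

Lemma quo_mulV : left_inverse quo_one quo_inv quo_mul.
Proof. by move=> a; rewrite -[a]reprK quo_invE quo_mulE mulVg. Qed.

Lemma quo_mulrV : right_inverse quo_one quo_inv quo_mul.
Proof. by move=> a; rewrite -[a]reprK quo_invE quo_mulE mulgV. Qed.

HB.instance Definition _ := isGroup.Build quotientGroup
  quo_mulA quo_mul1 quo_mulr1 quo_mulV quo_mulrV.

End QuotientGroup.

Definition isomorphic_groups (G H : groupType) : Prop :=
  exists f : {multiplicative G -> H}, bijective f.

Record category := Category {
  obj :> Type;
  hom : obj -> obj -> Type;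
  idm : forall A, hom A A;
  compm : forall A B C, hom B C -> hom A B -> hom A C;
  compA : forall A B C D (h : hom C D) (g : hom B C) (f : hom A B),
    compm h (compm g f) = compm (compm h g) f;
  comp1m : forall A B (f : hom A B), compm (idm B) f = f;
  compm1 : forall A B (f : hom A B), compm f (idm A) = f
}.
Arguments idm {c} A.

Definition is_iso (C : category) (A B : C) (f : hom A B) : Prop :=
  exists g : hom B A, compm g f = idm A /\ compm f g = idm B.

Record functor (C D : category) := Functor {
  fobj :> C -> D;
  fmap : forall A B, hom A B -> hom (fobj A) (fobj B);
  fmap1 : forall A, fmap (idm A) = idm (fobj A);
  fmapM : forall A B E (g : hom B E) (f : hom A B),
    fmap (compm g f) = compm (fmap g) (fmap f)
}.
Arguments fmap {C D} _ {A B} _.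

Lemma functor_eq (C D : category) (o : C -> D)
    (m m' : forall A B, hom A B -> hom (o A) (o B)) p q p' q' :
  m = m' -> @Functor C D o m p q = @Functor C D o m' p' q'.
Proof. by move=> e; subst m'; congr Functor; exact: Prop_irrelevance. Qed.

Section FunctorComposition.

Definition idF (C : category) : functor C C :=
  @Functor C C (fun A => A) (fun A B f => f)
    (fun A => erefl) (fun A B E g f => erefl).

Variables C D E : category.

Lemma compF1 (G : functor D E) (F : functor C D) A :
  fmap G (fmap F (idm A)) = idm (G (F A)).
Proof. by rewrite !fmap1. Qed.

Lemma compFM (G : functor D E) (F : functor C D) A B A'
    (g : hom B A') (f : hom A B) :
  fmap G (fmap F (compm g f))
  = compm (fmap G (fmap F g)) (fmap G (fmap F f)).
Proof. by rewrite !fmapM. Qed.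

Definition compF (G : functor D E) (F : functor C D) : functor C E :=
  @Functor C E (fun A => G (F A)) (fun A B f => fmap G (fmap F f))
    (compF1 G F) (@compFM G F).

End FunctorComposition.

Lemma compFA (C D E E' : category) (H : functor E E') (G : functor D E)
  (F : functor C D) : compF H (compF G F) = compF (compF H G) F.
Proof. exact: functor_eq. Qed.

Lemma comp1F (C D : category) (F : functor C D) : compF (idF D) F = F.
Proof. by case: F => o m p q; exact: functor_eq. Qed.

Lemma compF1r (C D : category) (F : functor C D) : compF F (idF C) = F.
Proof. by case: F => o m p q; exact: functor_eq. Qed.

Definition invertible_functor (C D : category) (F : functor C D) : Prop :=
  exists G : functor D C, compF G F = idF C /\ compF F G = idF D.

Record autCat (C : category) := AutCat {
  aut_functor :> functor C C;
  aut_invertible : invertible_functor aut_functor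
}.

HB.instance Definition _ (C : category) := gen_eqMixin (autCat C).
HB.instance Definition _ (C : category) := gen_choiceMixin (autCat C).

Section AutCatGroup.
Variable C : category.
Implicit Types F G H : autCat C.

Lemma autCat_eq F G : aut_functor F = aut_functor G -> F = G.
Proof.
case: F G => [F pF] [G pG] /= e; subst G; congr AutCat; exact: Prop_irrelevance.
Qed.

Lemma idF_invertible : invertible_functor (idF C).
Proof. by exists (idF C); rewrite comp1F. Qed.

Lemma compF_invertible F G : invertible_functor (compF F G).
Proof.
case: F G => [F [F' [F1 F2]]] [G [G' [G1 G2]]] /=.
exists (compF G' F'); split.
  by rewrite -compFA (compFA F' F) F1 comp1F.
by rewrite -compFA (compFA G G') G2 comp1F.
Qed.

Definition invF F : functor C C := projT1 (cid (aut_invertible F)).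

Lemma invFl F : compF (invF F) F = idF C.
Proof. by rewrite /invF; case: cid => G []. Qed.

Lemma invFr F : compF F (invF F) = idF C.
Proof. by rewrite /invF; case: cid => G []. Qed.

Lemma invF_invertible F : invertible_functor (invF F).
Proof. by exists F; rewrite invFl invFr. Qed.

Definition autCat_one := AutCat idF_invertible.
Definition autCat_mul F G := AutCat (compF_invertible F G).
Definition autCat_inv F := AutCat (invF_invertible F).

Lemma autCat_mulA : associative autCat_mul.
Proof. by move=> F G H; apply: autCat_eq; exact: compFA. Qed.
Lemma autCat_mul1 : left_id autCat_one autCat_mul.
Proof. by move=> F; apply: autCat_eq; exact: comp1F. Qed.
Lemma autCat_mulr1 : right_id autCat_one autCat_mul.
Proof. by move=> F; apply: autCat_eq; exact: compF1r. Qed.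
Lemma autCat_mulV : left_inverse autCat_one autCat_inv autCat_mul.
Proof. by move=> F; apply: autCat_eq; exact: invFl. Qed.
Lemma autCat_mulrV : right_inverse autCat_one autCat_inv autCat_mul.
Proof. by move=> F; apply: autCat_eq; exact: invFr. Qed.

HB.instance Definition _ := isGroup.Build (autCat C)
  autCat_mulA autCat_mul1 autCat_mulr1 autCat_mulV autCat_mulrV.

End AutCatGroup.

Section InnerAutomorphisms.
Variable C : category.

Definition isomorphic_functors (F G : functor C C) : Prop :=
  exists s : forall A, hom (F A) (G A),
    (forall A, is_iso (s A)) /\
    (forall A B (psi : hom A B),
      compm (fmap G psi) (s A) = compm (s B) (fmap F psi)).

Definition inner (F : autCat C) : Prop := isomorphic_functors (idF C) F.

Lemma isoF_refl F : isomorphic_functors F F.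
Proof.
exists (fun A => idm (F A)); split=> [A|A B psi]; last by rewrite compm1 comp1m.
by exists (idm (F A)); rewrite comp1m.
Qed.

Lemma isoF_sym F G : isomorphic_functors F G -> isomorphic_functors G F.
Proof.
case=> s [sI sN]; pose t A := projT1 (cid (sI A)).
have ts A : compm (t A) (s A) = idm (F A) by rewrite /t; case: cid => ? [].
have st A : compm (s A) (t A) = idm (G A) by rewrite /t; case: cid => ? [].
exists t; split=> [A|A B psi]; first by exists (s A).
rewrite -[LHS]comp1m -(ts B) -compA (compA (s B)) -sN.
by rewrite -!compA st compm1.
Qed.

Lemma isoF_trans F G H : isomorphic_functors F G -> isomorphic_functors G H ->
  isomorphic_functors F H.
Proof.
case=> s [sI sN] [t [tI tN]]; exists (fun A => compm (t A) (s A)).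
split=> [A|A B psi]; last by rewrite compA tN -compA sN compA.
have [s' [s1 s2]] := sI A; have [t' [t1 t2]] := tI A.
exists (compm s' t'); split.
  by rewrite -compA (compA t') t1 comp1m.
by rewrite -compA (compA (s A)) s2 comp1m.
Qed.

Lemma isoF_comp F G F' G' : isomorphic_functors F F' ->
  isomorphic_functors G G' -> isomorphic_functors (compF F G) (compF F' G').
Proof.
case=> s [sI sN] [t [tI tN]]; apply: (@isoF_trans _ (compF F G')).
  exists (fun A => fmap F (t A)); split=> [A|A B psi] /=; last first.
    by rewrite -!fmapM tN.
  by have [u [u1 u2]] := tI A; exists (fmap F u); rewrite -!fmapM u1 u2 !fmap1.
exists (fun A => s (G' A)); split=> [A|A B psi] /=; first exact: sI.
by rewrite sN.
Qed.

Lemma inner1 : inner 1%g.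
Proof. exact: isoF_refl. Qed.

Lemma innerM (F G : autCat C) : inner F -> inner G -> inner (F * G)%g.
Proof.
by move=> iF iG; have := isoF_comp iF iG; rewrite comp1F.
Qed.

Lemma innerV (F : autCat C) : inner F -> inner F^-1%g.
Proof.
move=> iF; apply: isoF_sym.
have := isoF_comp (isoF_refl (F^-1)%g) iF.
by rewrite compF1r invFl => h; exact: h.
Qed.

Lemma innerJ (F G : autCat C) : inner F -> inner (F ^ G)%g.
Proof.
move=> iF; have := isoF_comp (isoF_refl (G^-1)%g) (isoF_comp iF (isoF_refl G)).
by rewrite comp1F invFl.
Qed.

Definition innerSubgroup : normalSubgroup (autCat C) :=
  NormalSubgroup inner1 innerM innerV innerJ.

End InnerAutomorphisms.

Record fieldAut (k : fieldType) := FieldAut {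
  faut_fun :> {rmorphism k -> k};
  faut_bij : bijective faut_fun
}.

HB.instance Definition _ (k : fieldType) := gen_eqMixin (fieldAut k).
HB.instance Definition _ (k : fieldType) := gen_choiceMixin (fieldAut k).

Section FieldAutGroup.
Variable k : fieldType.
Implicit Types f g h : fieldAut k.

Lemma fieldAut_eq f g : f =1 g -> f = g.
Proof.
case: f g => [[f [[[f0 fD]] [fM]]] bf] [[g [[[g0 gD]] [gM]]] bg] /= /funext e.
subst g.
rewrite (Prop_irrelevance g0 f0) (Prop_irrelevance gD fD).
rewrite (Prop_irrelevance gM fM) in bg *.
by congr FieldAut; exact: Prop_irrelevance.
Qed.

Lemma faut_id_bij : bijective (idfun : {rmorphism k -> k}).
Proof. by exists idfun. Qed.

Lemma faut_comp_bij f g : bijective (f \o g : {rmorphism k -> k}).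
Proof. by apply: bij_comp; exact: faut_bij. Qed.

Lemma faut_inv_ex f : exists h : k -> k, cancel f h /\ cancel h f.
Proof. by case: (faut_bij f) => h fh hf; exists h. Qed.

Definition faut_inv_fun f : k -> k := projT1 (cid (faut_inv_ex f)).

Lemma faut_invK f : cancel f (faut_inv_fun f).
Proof. by rewrite /faut_inv_fun; case: cid => g []. Qed.

Lemma faut_invKV f : cancel (faut_inv_fun f) f.
Proof. by rewrite /faut_inv_fun; case: cid => g []. Qed.

Lemma faut_inv_zmod f : zmod_morphism (faut_inv_fun f).
Proof. exact: (can2_zmod_morphism (faut_invK f) (faut_invKV f)). Qed.

Lemma faut_inv_monoid f : monoid_morphism (faut_inv_fun f).
Proof. exact: (can2_monoid_morphism (faut_invK f) (faut_invKV f)). Qed.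

HB.instance Definition _ f :=
  GRing.isZmodMorphism.Build k k (faut_inv_fun f) (faut_inv_zmod f).
HB.instance Definition _ f :=
  GRing.isMonoidMorphism.Build k k (faut_inv_fun f) (faut_inv_monoid f).

Lemma faut_inv_bij f : bijective (faut_inv_fun f : {rmorphism k -> k}).
Proof. by exists f; [exact: faut_invKV | exact: faut_invK]. Qed.

Definition fieldAut_one := FieldAut faut_id_bij.
Definition fieldAut_mul f g := FieldAut (faut_comp_bij f g).
Definition fieldAut_inv f := FieldAut (faut_inv_bij f).

Lemma fieldAut_mulA : associative fieldAut_mul.
Proof. by move=> f g h; apply: fieldAut_eq. Qed.
Lemma fieldAut_mul1 : left_id fieldAut_one fieldAut_mul.
Proof. by move=> f; apply: fieldAut_eq. Qed.
Lemma fieldAut_mulr1 : right_id fieldAut_one fieldAut_mul.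
Proof. by move=> f; apply: fieldAut_eq. Qed.
Lemma fieldAut_mulV : left_inverse fieldAut_one fieldAut_inv fieldAut_mul.
Proof. by move=> f; apply: fieldAut_eq; exact: faut_invK. Qed.
Lemma fieldAut_mulrV : right_inverse fieldAut_one fieldAut_inv fieldAut_mul.
Proof. by move=> f; apply: fieldAut_eq; exact: faut_invKV. Qed.

HB.instance Definition _ := isGroup.Build (fieldAut k)
  fieldAut_mulA fieldAut_mul1 fieldAut_mulr1 fieldAut_mulV fieldAut_mulrV.

End FieldAutGroup.

HB.mixin Record Lmodule_isLinAlg (k : fieldType) A of GRing.Lmodule k A := {
  amul : A -> A -> A;
  amulDl : left_distributive amul +%R;
  amulDr : right_distributive amul +%R;
  amulZl : forall (a : k) (x y : A), amul (a *: x) y = a *: amul x y;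
  amulZr : forall (a : k) (x y : A), amul x (a *: y) = a *: amul x y
}.

#[short(type="linAlgType")]
HB.structure Definition LinAlg (k : fieldType) :=
  {A of Lmodule_isLinAlg k A & GRing.Lmodule k A}.

Definition alternative (k : fieldType) (A : linAlgType k) : Prop :=
  forall x1 x2 : A,
    amul (amul x1 x1) x2 = amul x1 (amul x1 x2) /\
    amul x2 (amul x1 x1) = amul (amul x2 x1) x1.

Record algHom (k : fieldType) (A B : linAlgType k) := AlgHom {
  algHom_fun :> A -> B;
  algHom_linear : linear algHom_fun;
  algHom_mul : {morph algHom_fun : x y / amul x y}
}.

Section AlgHomTheory.
Variable k : fieldType.
Implicit Types A B C D : linAlgType k.

HB.instance Definition _ A B (f : algHom A B) :=
  GRing.isLinear.Build k A B *:%R f (algHom_linear f).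

Lemma algHom_eq A B (f g : algHom A B) : f =1 g -> f = g.
Proof.
case: f g => [f lf mf] [g lg mg] /= /funext e; subst g.
by congr AlgHom; exact: Prop_irrelevance.
Qed.

Lemma id_algHom_linear A : linear (@id A).
Proof. by []. Qed.

Definition id_algHom A : algHom A A :=
  @AlgHom k A A id (@id_algHom_linear A) (fun x y => erefl).

Lemma comp_algHom_linear A B C (g : algHom B C) (f : algHom A B) :
  linear (g \o f).
Proof. by move=> a x y /=; rewrite !linearP. Qed.

Lemma comp_algHom_mul A B C (g : algHom B C) (f : algHom A B) :
  {morph g \o f : x y / amul x y}.
Proof. by move=> x y /=; rewrite !algHom_mul. Qed.

Definition comp_algHom A B C (g : algHom B C) (f : algHom A B) : algHom A C :=
  AlgHom (comp_algHom_linear g f) (comp_algHom_mul g f).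

Lemma comp_algHomA A B C D (h : algHom C D) (g : algHom B C)
    (f : algHom A B) :
  comp_algHom h (comp_algHom g f) = comp_algHom (comp_algHom h g) f.
Proof. exact: algHom_eq. Qed.

Lemma comp1_algHom A B (f : algHom A B) : comp_algHom (id_algHom B) f = f.
Proof. exact: algHom_eq. Qed.

Lemma comp_algHom1 A B (f : algHom A B) : comp_algHom f (id_algHom A) = f.
Proof. exact: algHom_eq. Qed.

End AlgHomTheory.

(* Terms over the variables [V] in the signature 0, +, . and the unary
   operations given by the scalars; the free algebra of the variety is the
   quotient of the terms by the congruence [altCong] generated by its
   identities.  Additive inverses need no separate operation: they are given
   by the scalar -1. *)
Inductive altTerm (k : fieldType) (V : Type) : Type :=
| TVar of V
| TZero
| TAdd of altTerm k V & altTerm k V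
| TScale of k & altTerm k V
| TMul of altTerm k V & altTerm k V.

Arguments TVar {k V} _.
Arguments TZero {k V}.

HB.instance Definition _ k V := gen_eqMixin (altTerm k V).
HB.instance Definition _ k V := gen_choiceMixin (altTerm k V).

Section FreeAlternative.
Variables (k : fieldType) (V : Type).
Local Notation term := (altTerm k V).
Local Notation "s + t" := (TAdd s t).
Local Notation "s * t" := (TMul s t).
Local Notation "a *: t" := (TScale a t).

Inductive altCong : term -> term -> Prop :=
| ac_refl t : altCong t t
| ac_sym s t : altCong s t -> altCong t s
| ac_trans s t u : altCong s t -> altCong t u -> altCong s u
| ac_add s s' t t' : altCong s s' -> altCong t t' -> altCong (s + t) (s' + t')
| ac_scale a t t' : altCong t t' -> altCong (a *: t) (a *: t')
| ac_mul s s' t t' : altCong s s' -> altCong t t' -> altCong (s * t) (s' * t')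
| ac_addA s t u : altCong (s + (t + u)) ((s + t) + u)
| ac_addC s t : altCong (s + t) (t + s)
| ac_add0 t : altCong (TZero + t) t
| ac_addN t : altCong ((-1)%R *: t + t) TZero
| ac_scaleA a b t : altCong (a *: (b *: t)) ((a * b)%R *: t)
| ac_scale1 t : altCong (1%R *: t) t
| ac_scaleDr a s t : altCong (a *: (s + t)) (a *: s + a *: t)
| ac_scaleDl a b t : altCong ((a + b)%R *: t) (a *: t + b *: t)
| ac_mulDl s t u : altCong ((s + t) * u) (s * u + t * u)
| ac_mulDr s t u : altCong (s * (t + u)) (s * t + s * u)
| ac_mulZl a s t : altCong ((a *: s) * t) (a *: (s * t))
| ac_mulZr a s t : altCong (s * (a *: t)) (a *: (s * t))
| ac_altl s t : altCong ((s * s) * t) (s * (s * t))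
| ac_altr s t : altCong (t * (s * s)) ((t * s) * s).

Definition altCongb : rel term := fun s t => `[< altCong s t >].

Lemma altCongb_refl : reflexive altCongb.
Proof. by move=> t; apply/asboolP; exact: ac_refl. Qed.

Lemma altCongb_sym : symmetric altCongb.
Proof. by move=> s t; apply/asboolP/asboolP; exact: ac_sym. Qed.

Lemma altCongb_trans : transitive altCongb.
Proof.
by move=> t s u /asboolP h1 /asboolP h2; apply/asboolP; exact: ac_trans h1 h2.
Qed.

Canonical altCong_equiv_rel :=
  EquivRel altCongb altCongb_refl altCongb_sym altCongb_trans.

Definition freeAlt := {eq_quot altCong_equiv_rel}.

HB.instance Definition _ : EqQuotient _ altCong_equiv_rel freeAlt :=
  EqQuotient.on freeAlt.
HB.instance Definition _ := Choice.on freeAlt.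

Lemma freeAlt_eq (s t : term) : \pi_freeAlt s = \pi_freeAlt t <-> altCong s t.
Proof. split=> [/eqmodP/asboolP //|h]; apply/eqmodP; exact/asboolP. Qed.

Lemma freeAlt_repr (t : term) : altCong (repr (\pi_freeAlt t)) t.
Proof. by apply/freeAlt_eq; rewrite reprK. Qed.

Definition fa_gen (v : V) : freeAlt := \pi_freeAlt (TVar v).
Definition fa_zero : freeAlt := \pi_freeAlt TZero.
Definition fa_add (x y : freeAlt) : freeAlt := \pi_freeAlt (repr x + repr y).
Definition fa_scale (a : k) (x : freeAlt) : freeAlt :=
  \pi_freeAlt (a *: repr x).
Definition fa_mul (x y : freeAlt) : freeAlt := \pi_freeAlt (repr x * repr y).
Definition fa_opp (x : freeAlt) : freeAlt := fa_scale (-1) x.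

Lemma fa_addE s t : fa_add (\pi_freeAlt s) (\pi_freeAlt t)
  = \pi_freeAlt (s + t).
Proof. by apply/freeAlt_eq/ac_add; exact: freeAlt_repr. Qed.
Lemma fa_scaleE a t : fa_scale a (\pi_freeAlt t) = \pi_freeAlt (a *: t).
Proof. by apply/freeAlt_eq/ac_scale; exact: freeAlt_repr. Qed.
Lemma fa_mulE s t : fa_mul (\pi_freeAlt s) (\pi_freeAlt t)
  = \pi_freeAlt (s * t).
Proof. by apply/freeAlt_eq/ac_mul; exact: freeAlt_repr. Qed.

Lemma fa_addA : associative fa_add.
Proof.
elim/quotW=> x; elim/quotW=> y; elim/quotW=> z.
rewrite (fa_addE y z) (fa_addE x y) !fa_addE.
exact/freeAlt_eq/ac_addA.
Qed.
Lemma fa_addC : commutative fa_add.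
Proof.
elim/quotW=> x; elim/quotW=> y; rewrite !fa_addE; exact/freeAlt_eq/ac_addC.
Qed.
Lemma fa_add0 : left_id fa_zero fa_add.
Proof. by elim/quotW=> x; rewrite fa_addE; apply/freeAlt_eq/ac_add0. Qed.
Lemma fa_addN : left_inverse fa_zero fa_opp fa_add.
Proof.
elim/quotW=> x; rewrite /fa_opp (fa_scaleE (-1) x) fa_addE.
exact/freeAlt_eq/ac_addN.
Qed.

HB.instance Definition _ :=
  GRing.isZmodule.Build freeAlt fa_addA fa_addC fa_add0 fa_addN.

Lemma pi_freeAltD s t :
  \pi_freeAlt (s + t) = ((\pi_freeAlt s : freeAlt) + \pi_freeAlt t)%R.
Proof. by rewrite [RHS]fa_addE. Qed.

Lemma fa_scaleA a b x : fa_scale a (fa_scale b x) = fa_scale (a * b) x.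
Proof.
elim/quotW: x => x; rewrite (fa_scaleE b) !fa_scaleE.
exact/freeAlt_eq/ac_scaleA.
Qed.

Lemma fa_scale1 : left_id 1%R fa_scale.
Proof. by elim/quotW=> x; rewrite fa_scaleE; apply/freeAlt_eq/ac_scale1. Qed.

Lemma fa_scaleDr : right_distributive fa_scale +%R.
Proof.
move=> a; elim/quotW=> x; elim/quotW=> y.
rewrite -pi_freeAltD (fa_scaleE a x) (fa_scaleE a y) fa_scaleE -pi_freeAltD.
exact/freeAlt_eq/ac_scaleDr.
Qed.

Lemma fa_scaleDl x : {morph fa_scale^~ x : a b / (a + b)%R}.
Proof.
elim/quotW: x => x a b.
rewrite (fa_scaleE a x) (fa_scaleE b x) fa_scaleE -pi_freeAltD.
exact/freeAlt_eq/ac_scaleDl.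
Qed.

HB.instance Definition _ := GRing.Zmodule_isLmodule.Build k freeAlt
  fa_scaleA fa_scale1 fa_scaleDr fa_scaleDl.

Lemma pi_freeAltZ a t :
  \pi_freeAlt (a *: t) = (a *: (\pi_freeAlt t : freeAlt))%R.
Proof. by rewrite [RHS]fa_scaleE. Qed.

Lemma fa_mulDl : left_distributive fa_mul +%R.
Proof.
elim/quotW=> x; elim/quotW=> y; elim/quotW=> z.
rewrite -pi_freeAltD (fa_mulE x z) (fa_mulE y z) fa_mulE -pi_freeAltD.
exact/freeAlt_eq/ac_mulDl.
Qed.

Lemma fa_mulDr : right_distributive fa_mul +%R.
Proof.
elim/quotW=> x; elim/quotW=> y; elim/quotW=> z.
rewrite -pi_freeAltD (fa_mulE x y) (fa_mulE x z) fa_mulE -pi_freeAltD.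
exact/freeAlt_eq/ac_mulDr.
Qed.

Lemma fa_mulZl (a : k) (x y : freeAlt) :
  (fa_mul (a *: x) y = a *: fa_mul x y)%R.
Proof.
elim/quotW: x => x; elim/quotW: y => y.
rewrite -pi_freeAltZ (fa_mulE x y) fa_mulE -pi_freeAltZ.
exact/freeAlt_eq/ac_mulZl.
Qed.

Lemma fa_mulZr (a : k) (x y : freeAlt) :
  (fa_mul x (a *: y) = a *: fa_mul x y)%R.
Proof.
elim/quotW: x => x; elim/quotW: y => y.
rewrite -pi_freeAltZ (fa_mulE x y) fa_mulE -pi_freeAltZ.
exact/freeAlt_eq/ac_mulZr.
Qed.

HB.instance Definition _ := Lmodule_isLinAlg.Build k freeAlt
  fa_mulDl fa_mulDr fa_mulZl fa_mulZr.

Lemma pi_freeAltM s t :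
  \pi_freeAlt (s * t) = amul (\pi_freeAlt s : freeAlt) (\pi_freeAlt t).
Proof. by rewrite [RHS]fa_mulE. Qed.

Lemma freeAlt_alternative : alternative freeAlt.
Proof.
elim/quotW=> x; elim/quotW=> y.
rewrite -(pi_freeAltM x x) -(pi_freeAltM x y) -(pi_freeAltM y x) -!pi_freeAltM.
by split; apply/freeAlt_eq; [exact: ac_altl | exact: ac_altr].
Qed.

End FreeAlternative.

Section UniversalProperty.
Variables (k : fieldType) (V : Type) (A : linAlgType k) (g : V -> A).

Fixpoint teval (t : altTerm k V) : A :=
  match t with
  | TVar v => g v
  | TZero => 0
  | TAdd s t => teval s + teval t
  | TScale a t => a *: teval t
  | TMul s t => amul (teval s) (teval t)
  end.

Hypothesis altA : alternative A.

Lemma teval_cong s t : altCong s t -> teval s = teval t.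
Proof.
elim=> //=.
- by move=> ? ? ? _ -> _ ->.
- by move=> ? ? ? ? _ -> _ ->.
- by move=> ? ? ? _ ->.
- by move=> ? ? ? ? _ -> _ ->.
- by move=> *; rewrite addrA.
- by move=> *; rewrite addrC.
- by move=> *; rewrite add0r.
- by move=> *; rewrite scaleN1r addNr.
- by move=> *; rewrite scalerA.
- by move=> *; rewrite scale1r.
- by move=> *; rewrite scalerDr.
- by move=> *; rewrite scalerDl.
- by move=> *; rewrite amulDl.
- by move=> *; rewrite amulDr.
- by move=> *; rewrite amulZl.
- by move=> *; rewrite amulZr.
- by move=> s0 t0; case: (altA (teval s0) (teval t0)).
- by move=> s0 t0; case: (altA (teval s0) (teval t0)).
Qed.

Lemma freeAlt_universal :
  exists! f : algHom (freeAlt k V) A, forall v, f (fa_gen k v) = g v.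
Proof.
pose f (x : freeAlt k V) := teval (repr x).
have fE t : f (\pi_(freeAlt k V) t) = teval t.
  by apply: teval_cong; exact: freeAlt_repr.
have lf : linear f.
  move=> a; elim/quotW=> x; elim/quotW=> y.
  by rewrite -pi_freeAltZ -pi_freeAltD !fE.
have mf : {morph f : x y / amul x y}.
  by elim/quotW=> x; elim/quotW=> y; rewrite -pi_freeAltM !fE.
exists (AlgHom lf mf); split=> [v|h hE]; first exact: fE.
apply: algHom_eq => x; rewrite -[x]reprK /= fE.
elim: (repr x) => [v||s IHs t IHt|a t IHt|s IHs t IHt] /=.
- by rewrite -hE.
- by rewrite -(linear0 h).
- by rewrite IHs IHt -linearD pi_freeAltD.
- by rewrite IHt -linearZ pi_freeAltZ.
- by rewrite IHs IHt -algHom_mul pi_freeAltM.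
Qed.

End UniversalProperty.

(* The variables x_1, x_2, ... are indexed by [nat]; the object [X] stands for
   the free algebra F(X) on the finite set of variables [X]. *)
Section Theta0.
Variable k : fieldType.

Definition freeAltOn (X : {fset nat}) : linAlgType k := freeAlt k X.

Definition Theta0 : category :=
  @Category {fset nat} (fun X Y => algHom (freeAltOn X) (freeAltOn Y))
    (fun X => id_algHom (freeAltOn X))
    (fun X Y Z g f => comp_algHom g f)
    (fun X Y Z T h g f => comp_algHomA h g f)
    (fun X Y f => comp1_algHom f)
    (fun X Y f => comp_algHom1 f).

End Theta0.

(* Main.v *)
(* An automorphism U is represented on elements: an element a of F(X) is a
   homomorphism F(x) -> F(X), and applying U to it gives natural bijections
   s_X : F(X) -> F(U X), since U preserves rank one.  Transporting the
   operations of F(U X) back along s gives operations on F(X) that commute with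
   all homomorphisms, hence are given by elements of F(x) and F(x, y).
   Multiplication by a scalar becomes an invertible polynomial in one variable,
   so it is a -> psi(a); comparing eigenvalues of the dilations x -> 2x, the sum
   stays the sum and the product becomes al xy + be yx; the alternative law,
   evaluated in 2 x 2 matrices, forces al be = 0.  So U is conjugation by
   semilinear multiplicative or antimultiplicative bijections, and the
   field automorphism together with the choice between the two kinds
   determines U up to inner automorphisms. *)

From HB Require Import structures.
Require Import Defs.
From mathcomp Require Import all_boot all_algebra perm.
From mathcomp Require Import finmap boolp.

Set Implicit Arguments.
Unset Strict Implicit.
Unset Printing Implicit Defensive.

Import GRing.Theory.
Local Open Scope ring_scope.
Local Open Scope quotient_scope.

(** * Zero homomorphisms, and the associative and twisted algebras used as targets *)

Lemma amul0l (k : fieldType) (A : linAlgType k) (x : A) : amul 0 x = 0.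
Proof. by have := amulZl 0 0 x; rewrite !scale0r. Qed.

Lemma amul0r (k : fieldType) (A : linAlgType k) (x : A) : amul x 0 = 0.
Proof. by have := amulZr 0 x 0; rewrite !scale0r. Qed.

Lemma zero_algHom_mul (k : fieldType) (A B : linAlgType k) :
  {morph (fun _ : A => 0 : B) : x y / amul x y}.
Proof. by move=> x y; rewrite amul0l. Qed.

Lemma zero_algHom_linear (k : fieldType) (A B : linAlgType k) :
  linear (fun _ : A => 0 : B).
Proof. by move=> a x y; rewrite scaler0 addr0. Qed.

Definition zero_algHom (k : fieldType) (A B : linAlgType k) : algHom A B :=
  AlgHom (@zero_algHom_linear k A B) (@zero_algHom_mul k A B).

Section AssociativeAlgebra.
Variables (k : fieldType) (R : algType k).

(** Polynomials and matrices, viewed as alternative algebras, serve as test objects: relations in a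
    free algebra are detected by mapping into them. *)
Definition assocAlg : Type := R.
HB.instance Definition _ := GRing.Lmodule.on assocAlg.

Definition assoc_mul (x y : assocAlg) : assocAlg := (x : R) * y.

Lemma assoc_mulDl : left_distributive assoc_mul +%R.
Proof. by move=> x y z; exact: mulrDl. Qed.
Lemma assoc_mulDr : right_distributive assoc_mul +%R.
Proof. by move=> x y z; exact: mulrDr. Qed.
Lemma assoc_mulZl a (x y : assocAlg) :
  assoc_mul (a *: x) y = a *: assoc_mul x y.
Proof. exact: (esym (scalerAl a (x : R) y)). Qed.
Lemma assoc_mulZr a (x y : assocAlg) :
  assoc_mul x (a *: y) = a *: assoc_mul x y.
Proof. exact: (esym (scalerAr a (x : R) y)). Qed.

HB.instance Definition _ := Lmodule_isLinAlg.Build k assocAlg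
  assoc_mulDl assoc_mulDr assoc_mulZl assoc_mulZr.

Lemma assocAlg_alternative : alternative assocAlg.
Proof.
move=> x y; split; first exact: (esym (mulrA (x : R) x y)).
exact: (mulrA (y : R) x x).
Qed.

End AssociativeAlgebra.

(* The scalar [a] acts as [phi a], and the product is reversed when [e]. *)
Definition twist (k : fieldType) (phi : {rmorphism k -> k}) (e : bool)
  (A : linAlgType k) : Type := A.

Section Twist.
Variables (k : fieldType) (phi : {rmorphism k -> k}) (e : bool).
Variable A : linAlgType k.

Local Notation twist := (twist phi e A).
HB.instance Definition _ := GRing.Zmodule.on twist.

Definition twist_scale (a : k) (x : twist) : twist := phi a *: (x : A).
Lemma twist_scaleA a b x :
  twist_scale a (twist_scale b x) = twist_scale (a * b) x.
Proof. by rewrite /twist_scale scalerA rmorphM. Qed.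
Lemma twist_scale1 : left_id 1 twist_scale.
Proof. by move=> x; rewrite /twist_scale rmorph1 scale1r. Qed.
Lemma twist_scaleDr : right_distributive twist_scale +%R.
Proof. by move=> a x y; exact: scalerDr. Qed.
Lemma twist_scaleDl x : {morph twist_scale^~ x : a b / a + b}.
Proof. by move=> a b; rewrite /twist_scale rmorphD scalerDl. Qed.

HB.instance Definition _ := GRing.Zmodule_isLmodule.Build k twist
  twist_scaleA twist_scale1 twist_scaleDr twist_scaleDl.

Definition twist_mul (x y : twist) : twist :=
  if e then amul (y : A) x else amul (x : A) y.

Lemma twist_mulDl : left_distributive twist_mul +%R.
Proof.
by move=> x y z; rewrite /twist_mul; case: e; [exact: amulDr|exact: amulDl].
Qed.
Lemma twist_mulDr : right_distributive twist_mul +%R.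
Proof.
by move=> x y z; rewrite /twist_mul; case: e; [exact: amulDl|exact: amulDr].
Qed.
Lemma twist_mulZl a (x y : twist) : twist_mul (a *: x) y = a *: twist_mul x y.
Proof. by rewrite /twist_mul; case: e; [exact: amulZr|exact: amulZl]. Qed.
Lemma twist_mulZr a (x y : twist) : twist_mul x (a *: y) = a *: twist_mul x y.
Proof. by rewrite /twist_mul; case: e; [exact: amulZl|exact: amulZr]. Qed.

HB.instance Definition _ := Lmodule_isLinAlg.Build k twist
  twist_mulDl twist_mulDr twist_mulZl twist_mulZr.

Lemma twist_alternative : alternative A -> alternative twist.
Proof.
move=> altA x y; have [h1 h2] := altA x y.
by split; rewrite /amul /= /twist_mul; case: e.
Qed.

End Twist.

(** * Induction and extension of maps on free alternative algebras *)

Section FreeAlgebra.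
Variables (k : fieldType) (V : Type).
Local Notation F := (freeAlt k V).
Local Notation gen := (@fa_gen k V).

Lemma freeAlt_ind (P : F -> Prop) :
    (forall v, P (gen v)) -> P 0 ->
    (forall x y, P x -> P y -> P (x + y)) ->
    (forall a x, P x -> P (a *: x)) ->
    (forall x y, P x -> P y -> P (amul x y)) ->
  forall x, P x.
Proof.
move=> Pg P0 PD PZ PM x; rewrite -[x]reprK.
elim: (repr x) => [v||s Ps t Pt|a t Pt|s Ps t Pt].
- exact (Pg v).
- exact P0.
- by have := PD _ _ Ps Pt; rewrite -pi_freeAltD.
- by have := PZ a _ Pt; rewrite -pi_freeAltZ.
- by have := PM _ _ Ps Pt; rewrite -pi_freeAltM.
Qed.

Lemma freeAlt_hom_ext (A : linAlgType k) (f g : algHom F A) :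
  (forall v, f (gen v) = g (gen v)) -> f = g.
Proof.
move=> fg; apply: algHom_eq; elim/freeAlt_ind=> //.
- by rewrite !linear0.
- by move=> x y ex ey; rewrite !linearD /= ex ey.
- by move=> a x ex; rewrite !linearZ /= ex.
- by move=> x y ex ey; rewrite !algHom_mul ex ey.
Qed.

Definition fext (A : linAlgType k) (altA : alternative A) (g : V -> A) :
  algHom F A := projT1 (cid (freeAlt_universal g altA)).

Lemma fextE (A : linAlgType k) (altA : alternative A) (g : V -> A) v :
  fext altA g (gen v) = g v.
Proof. by rewrite /fext; case: cid => f [] /= ->. Qed.

End FreeAlgebra.

(** * Eigenvectors and homogeneous components *)

Section Eigenvectors.
Variables (k : fieldType) (M : lmodType k) (f : {linear M -> M}).
Variables (I : Type) (e : I -> k).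

(** The classical independence argument for eigenvectors: applying [f - e i] to the sum kills the
    head term and rescales each [H j] by [e j - e i]. The induction hypothesis for this rescaled
    family gives [(l - e i) *: q = 0], where [l - e i] is nonzero. *)
Lemma eigen_sum_eq0 (l : k) (r : seq I) (H : I -> M) :
    (forall i, f (H i) = e i *: H i) ->
    f (\sum_(i <- r | e i != l) H i) = l *: (\sum_(i <- r | e i != l) H i) ->
  \sum_(i <- r | e i != l) H i = 0.
Proof.
elim: r H => [|i r IH] H fH; first by rewrite big_nil.
rewrite big_cons; case: ifP => [ne|_]; last exact: IH.
set q := (H i + _) => fq.
have dq : (l - e i) *: q = \sum_(j <- r | e j != l) (e j - e i) *: H j.
  rewrite scalerBl -fq /q linearD linear_sum fH scalerDr opprD addrACA subrr.
  rewrite add0r scaler_sumr -sumrB.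
  by apply: eq_bigr => j _; rewrite fH scalerBl.
have /eqP : (l - e i) *: q = 0.
  rewrite dq; apply: IH => [j|]; first by rewrite linearZ /= fH !scalerA mulrC.
  by rewrite -dq linearZ /= fq !scalerA mulrC.
by rewrite scaler_eq0 subr_eq0 eq_sym (negPf ne) => /eqP.
Qed.

Lemma eigen_sum (l : k) (r : seq I) (H : I -> M) :
    (forall i, f (H i) = e i *: H i) ->
    f (\sum_(i <- r) H i) = l *: (\sum_(i <- r) H i) ->
  \sum_(i <- r) H i = \sum_(i <- r | e i == l) H i.
Proof.
move=> fH; rewrite (bigID (fun i => e i == l)) /= linearD scalerDr.
rewrite [in X in X + _ = _](linear_sum f) [in X in _ = X + _]scaler_sumr.
rewrite (@eq_bigr _ _ _ _ _ _ _ (fun i => l *: H i)); last first.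
  by move=> i /eqP <-.
by move=> /addrI /(eigen_sum_eq0 fH) ->; rewrite addr0.
Qed.

End Eigenvectors.

Inductive monom (V : Type) : Type :=
  MVar of V | MMul of monom V & monom V.

Fixpoint mdeg (V : Type) (d : V -> nat) (m : monom V) : nat :=
  match m with MVar v => d v | MMul m n => (mdeg d m + mdeg d n)%N end.

Section Monomials.
Variables (k : fieldType) (V : Type).
Local Notation F := (freeAlt k V).

Fixpoint meval (m : monom V) : F :=
  match m with MVar v => fa_gen k v | MMul m n => amul (meval m) (meval n) end.

(** Words satisfy relations in the free alternative algebra, so the list is not determined by the
    element. Homogeneity is therefore read off from eigenvalues of dilations instead of
    coefficients. *)
Definition lincomb (s : seq (k * monom V)) : F :=
  \sum_(t <- s) t.1 *: meval t.2.

Lemma amul_sumr (A : linAlgType k) I (r : seq I) (H : I -> A) x :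
  amul x (\sum_(i <- r) H i) = \sum_(i <- r) amul x (H i).
Proof.
apply: (big_morph (amul x)); first exact: amulDr.
exact: amul0r.
Qed.

Lemma amul_suml (A : linAlgType k) I (r : seq I) (H : I -> A) x :
  amul (\sum_(i <- r) H i) x = \sum_(i <- r) amul (H i) x.
Proof.
apply: (big_morph (fun y => amul y x)); last exact: amul0l.
by move=> y z; exact: amulDl.
Qed.

Lemma freeAlt_span (x : F) : exists s, x = lincomb s.
Proof.
rewrite /lincomb; elim/freeAlt_ind: x.
- by move=> v; exists [:: (1, MVar v)]; rewrite big_seq1 scale1r.
- by exists [::]; rewrite big_nil.
- by move=> x y [s ->] [t ->]; exists (s ++ t); rewrite big_cat.
- move=> a x [s ->]; exists [seq (a * t.1, t.2) | t <- s].
  by rewrite big_map scaler_sumr; apply: eq_bigr => t _; rewrite scalerA.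
move=> x y [s ->] [t ->].
exists [seq (p.1 * q.1, MMul p.2 q.2) | p <- s, q <- t].
rewrite big_allpairs_dep amul_suml; apply: eq_bigr => p _.
rewrite amul_sumr; apply: eq_bigr => q _ /=.
by rewrite amulZl amulZr scalerA.
Qed.

Variables (d : V -> nat) (c : k) (f : algHom F F).
Hypothesis fgen : forall v, f (fa_gen k v) = c ^+ d v *: fa_gen k v.

Lemma dilation_meval m : f (meval m) = c ^+ mdeg d m *: meval m.
Proof.
elim: m => [v|m IHm n IHn] /=; first exact: fgen.
by rewrite algHom_mul IHm IHn amulZl amulZr scalerA exprD.
Qed.

(** Each word is an eigenvector of the dilation, with eigenvalue [c] to its weighted degree. As
    [c ^+ n] differs from all other powers of [c], only words of degree [n] contribute. *)
Lemma dilation_homogeneous (n : nat) (s : seq (k * monom V)) :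
    (forall i, c ^+ i = c ^+ n -> i = n) ->
    f (lincomb s) = c ^+ n *: lincomb s ->
  lincomb s = lincomb [seq t <- s | mdeg d t.2 == n].
Proof.
move=> cn fs; rewrite /lincomb big_filter.
rewrite (eigen_sum (f := f) (e := fun t => c ^+ mdeg d t.2) _ fs).
  by apply: eq_bigl => t; apply/eqP/eqP => [/cn|->].
by move=> t; rewrite linearZ /= dilation_meval !scalerA mulrC.
Qed.

End Monomials.

(** * Power associativity and the free algebra on one generator *)

Section Powers.
Variables (k : fieldType) (A : linAlgType k) (x : A).
Hypothesis two_neq0 : 2%:R != 0 :> k.
Hypothesis altA : alternative A.

(** There is no unit, so exponents are shifted: this is the power [n.+1] of [x], bracketed to the
    left. *)
Definition apow (n : nat) : A := iter n (fun y => amul y x) x.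

(** Linearisation of the right alternative law: expand it at [a + b] and cancel the instances at [a]
    and at [b]. *)
Lemma alternative_polarized (y a b : A) :
  amul y (amul a b) + amul y (amul b a)
  = amul (amul y a) b + amul (amul y b) a.
Proof.
have [_] := altA (a + b) y; rewrite !(amulDl, amulDr).
have [_ ->] := altA a y; have [_ ->] := altA b y.
rewrite -!addrA => /addrI; rewrite !addrA => /addIr ->.
by rewrite addrC.
Qed.

(* [R_(x^(n+1)) = R_x^(n+1)], since [R_(ab+ba) = R_a R_b + R_b R_a] and powers
   of [x] commute with [x]. *)
Lemma amul_apow n y : amul y (apow n) = iter n.+1 (fun z => amul z x) y.
Proof.
elim: n y => [//|n IH] y; apply: (@scalerI _ _ 2%:R two_neq0).
rewrite !scaler_nat !mulr2n.
have -> : amul y (apow n.+1) + amul y (apow n.+1)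
    = amul y (amul (apow n) x) + amul y (amul x (apow n)).
  by rewrite (IH x).
by rewrite alternative_polarized !IH -(iterSr n.+1 (fun z => amul z x) y).
Qed.

Lemma apowD m n : amul (apow m) (apow n) = apow (m + n).+1.
Proof. by rewrite amul_apow /apow -iterD addSn addnC. Qed.

End Powers.

Lemma sum_by_fiber (k : fieldType) (M : lmodType k) (u : nat -> M)
    (r : seq (k * nat)) :
    (forall i, \sum_(t <- r | t.2 == i) t.1 = 0) ->
  \sum_(t <- r) t.1 *: u t.2 = 0.
Proof.
move=> r0; pose N := (\max_(t <- r) t.2).+1.
transitivity (\sum_(t <- r) \sum_(i < N | t.2 == i) t.1 *: u i).
  rewrite big_seq [RHS]big_seq; apply: eq_bigr => t tr.
  have tN : (t.2 < N)%N by rewrite ltnS; exact: (@leq_bigmax_seq _ _ _ snd).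
  by rewrite (big_pred1 (Ordinal tN)) // => i; rewrite eq_sym.
rewrite (exchange_big_dep predT) //= big1 // => i _.
by rewrite -scaler_suml r0 scale0r.
Qed.

Section OneGenerator.
Variables (k : fieldType) (V : Type) (v0 : V).
Hypothesis two_neq0 : 2%:R != 0 :> k.
Hypothesis one_gen : forall v : V, v = v0.
Local Notation F := (freeAlt k V).
Local Notation x0 := (fa_gen k v0).

Definition to_poly : algHom F (assocAlg {poly k}) :=
  fext (@assocAlg_alternative k {poly k}) (fun _ => 'X : {poly k}).

Lemma to_poly_mul (p q : F) :
  to_poly (amul p q) = (to_poly p : {poly k}) * to_poly q.
Proof. exact: algHom_mul. Qed.

Lemma to_poly_gen : to_poly x0 = 'X :> {poly k}.
Proof. by rewrite /to_poly fextE. Qed.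

Lemma to_poly_apow n : to_poly (apow x0 n) = 'X^(n.+1) :> {poly k}.
Proof.
elim: n => [|n IH] /=; first by rewrite to_poly_gen expr1.
by rewrite to_poly_mul IH to_poly_gen -exprSr.
Qed.

Lemma meval_apow (m : monom V) :
  exists e : nat, meval k m = apow x0 e.
Proof.
elim: m => [v|m [i ei] n [j ej]] /=; first by exists 0; rewrite (one_gen v).
exists (i + j).+1; rewrite ei ej apowD //; exact: freeAlt_alternative.
Qed.

(** Power associativity reduces every element to a combination of powers of [x0], and these map to
    independent powers of ['X]. Hence the free algebra on one generator is the ideal of polynomials
    without constant term, and endomorphisms become compositions. *)
Lemma to_poly_inj : injective to_poly.
Proof.
suff ker0 p : to_poly p = 0 -> p = 0.
  move=> p q /eqP; rewrite -subr_eq0 -linearB => /eqP /ker0 /eqP.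
  by rewrite subr_eq0 => /eqP.
have [s ->] := freeAlt_span p; pose e m := projT1 (cid (meval_apow m)).
have eE m : meval k m = apow x0 (e m) by rewrite /e; case: cid.
pose r := [seq (t.1, e t.2) | t <- s].
have -> : lincomb s = \sum_(t <- r) t.1 *: apow x0 t.2.
  by rewrite big_map; apply: eq_bigr => t _; rewrite eE.
rewrite linear_sum => r0; apply: sum_by_fiber => i.
have {r0} : \sum_(t <- r) t.1 *: 'X^(t.2.+1) = 0 :> {poly k}.
  rewrite -[RHS]r0; apply: eq_bigr => t _.
  by rewrite linearZ /= to_poly_apow.
move/(congr1 (fun q : {poly k} => q`_i.+1)).
rewrite coef_sumMXn coef0 => r0; rewrite -[RHS]r0.
by apply: eq_bigl => t; rewrite eqSS.
Qed.

Lemma to_poly_coef0 (p : F) : (to_poly p : {poly k})`_0 = 0.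
Proof.
elim/freeAlt_ind: p.
- by move=> v; rewrite (one_gen v) to_poly_gen coefX.
- by rewrite linear0 coef0.
- by move=> p q hp hq; rewrite linearD coefD hp hq addr0.
- by move=> a p hp; rewrite linearZ coefZ hp mulr0.
- by move=> p q hp hq; rewrite to_poly_mul coef0M hp mul0r.
Qed.

Lemma to_poly_coef1_mul (p q : F) : (to_poly (amul p q) : {poly k})`_1 = 0.
Proof.
rewrite to_poly_mul coefM big_ord_recr big_ord1 /=.
by rewrite !to_poly_coef0 mul0r mulr0 addr0.
Qed.

Lemma to_poly_comp (f : algHom F F) (p : F) :
  to_poly (f p) = (to_poly p : {poly k}) \Po to_poly (f x0).
Proof.
elim/freeAlt_ind: p.
- by move=> v; rewrite (one_gen v) to_poly_gen comp_polyX.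
- by rewrite !linear0.
- by move=> p q hp hq; rewrite !linearD /= hp hq.
- by move=> a p hp; rewrite !linearZ /= hp.
- by move=> p q hp hq; rewrite algHom_mul !to_poly_mul hp hq comp_polyM.
Qed.

Lemma to_poly_size2 (p : F) : size (to_poly p : {poly k}) = 2 ->
  p = (to_poly p : {poly k})`_1 *: x0.
Proof.
move=> sp; apply: to_poly_inj; rewrite linearZ /= to_poly_gen.
apply/polyP => i; rewrite coefZ coefX.
case: i => [|[|i]]; first by rewrite to_poly_coef0 mulr0.
  by rewrite mulr1.
by rewrite mulr0 nth_default // sp.
Qed.

Lemma invertible_endo_linear (f : algHom F F) (p : F) :
  f p = x0 -> exists c, p = c *: x0.
Proof.
move=> fp; exists (to_poly p : {poly k})`_1; apply: to_poly_size2.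
(* Degrees multiply under composition and the composite is ['X], so [p] has degree one. *)
have := size_comp_poly (to_poly p : {poly k}) (to_poly (f x0)).
rewrite -to_poly_comp fp to_poly_gen size_polyX /= => /esym/eqP.
by rewrite muln_eq1 => /andP[/eqP]; case: (size _) => [|[|[]]].
Qed.

(** An idempotent endomorphism is a polynomial [P] with [P \Po P = P]. Degrees multiply, so the
    degree is at most one; the constant term vanishes, and a nonzero linear coefficient equals its
    own square. *)
Lemma idempotent_endo (f : algHom F F) :
  (forall p, f (f p) = f p) -> f = zero_algHom F F \/ f = id_algHom F.
Proof.
move=> ff; pose P : {poly k} := to_poly (f x0).
have PP : P \Po P = P by rewrite -to_poly_comp ff.
have fx y : f x0 = y -> forall v : V, f (fa_gen k v) = y.
  by move=> fy v; rewrite (one_gen v).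
have P0 : P`_0 = 0 by exact: to_poly_coef0.
have := size_comp_poly P P; rewrite PP.
case sP : (size P) => [|[|n]] /=.
- move=> _; left; apply: freeAlt_hom_ext; apply: fx; apply: to_poly_inj.
  by apply/eqP; rewrite linear0 -size_poly_eq0; apply/eqP.
- move=> _; left; apply: freeAlt_hom_ext; apply: fx; apply: to_poly_inj.
  by rewrite linear0 -[LHS]/P (size1_polyC (eq_leq sP)) P0.
rewrite -{1}[n.+1]muln1 => /eqP; rewrite eqn_pmul2l // eqSS eq_sym => /eqP n0.
rewrite n0 in sP; have fx0 := to_poly_size2 sP.
have a1 : P`_1 = 1.
  have P1 : P`_1 != 0.
    by rewrite -[1%N]/(2.-1) -sP -lead_coefE lead_coef_eq0 -size_poly_eq0 sP.
  apply: (mulfI P1); rewrite mulr1 -{3}PP.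
  rewrite {2}/P fx0 linearZ /= to_poly_gen -/P.
  rewrite [in RHS]comp_polyE sP big_ord_recr big_ord1 /= P0 scale0r add0r.
  by rewrite expr1 !coefZ coefX mulr1.
right; apply: freeAlt_hom_ext => v; rewrite (one_gen v) /= {1}fx0.
by rewrite -/P a1 scale1r.
Qed.

End OneGenerator.

(** * Invertible functors are full and faithful *)

Lemma invertible_functor_inj (C D : category) (U : functor C D) (A B : C) :
  invertible_functor U -> injective (@fmap _ _ U A B).
Proof.
case=> G [GU _] f g fg.
(* The types of the images of [f] and [g] depend on the functor, so the claim is stated for a
   variable [H], for which the equation with [idF C] can be eliminated. *)
have idinj (H : functor C C) : H = idF C -> injective (@fmap _ _ H A B).
  by move=> -> f' g'.
by apply: (idinj _ GU); rewrite /= fg.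
Qed.

Lemma invertible_functor_surj (C D : category) (U : functor C D) (A B : C)
    (h : Defs.hom (U A) (U B)) :
  invertible_functor U -> exists f, @fmap _ _ U A B f = h.
Proof.
case=> G [GU UG].
have idsurj (H : functor C C) : H = idF C ->
    forall h', exists f, @fmap _ _ H A B f = h'.
  by move=> -> h'; exists h'.
have [f fh] := idsurj _ GU (fmap G h); exists f.
by apply: (invertible_functor_inj (U := G) _ fh); exists U.
Qed.

(** * Natural operations in one and two variables *)

Section Words.
Variable k : fieldType.
Local Notation F X := (freeAltOn k X).

Definition X1 : {fset nat} := [fset 0%N]%fset.
Definition X2 : {fset nat} := [fset 0%N; 1%N]%fset.
Definition i0 : X1 := [` fset11 0%N]%fset.
Definition i1 : X2 := [` fset21 0%N 1%N]%fset.
Definition i2 : X2 := [` fset22 0%N 1%N]%fset.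
Definition gx : F X1 := fa_gen k i0.
Definition ga : F X2 := fa_gen k i1.
Definition gb : F X2 := fa_gen k i2.

Lemma X1_single (v : X1) : v = i0.
Proof. by apply: val_inj; apply/fset1P; exact: (valP v). Qed.

Lemma X2_cases (v : X2) : v = i1 \/ v = i2.
Proof.
by have /fset2P[h|h] := valP v; [left|right]; exact: val_inj.
Qed.

Definition ev1 (A : linAlgType k) (altA : alternative A) (a : A) :
  algHom (F X1) A := fext altA (fun _ => a).
Definition ev2 (A : linAlgType k) (altA : alternative A) (a b : A) :
  algHom (F X2) A := fext altA (fun v : X2 => if v == i1 then a else b).

Lemma ev1E A altA a : @ev1 A altA a gx = a.
Proof. exact: fextE. Qed.
Lemma ev2a A altA a b : @ev2 A altA a b ga = a.
Proof. by rewrite /ev2 /ga fextE eqxx. Qed.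
Lemma ev2b A altA a b : @ev2 A altA a b gb = b.
Proof. by rewrite /ev2 /gb fextE. Qed.

Definition free_alt (X : {fset nat}) : alternative (F X) :=
  @freeAlt_alternative k X.

Lemma to_poly_gx : to_poly k X1 gx = 'X :> {poly k}.
Proof. exact: to_poly_gen. Qed.

Lemma fa_gen_neq0 (V : Type) (v : V) : fa_gen k v != 0.
Proof.
apply/eqP => /(congr1 (to_poly k V)); rewrite linear0.
by rewrite to_poly_gen => /eqP; rewrite polyX_eq0.
Qed.

Lemma gx_scale_inj (a b : k) : a *: gx = b *: gx -> a = b.
Proof.
move/eqP; rewrite -subr_eq0 -scalerBl scaler_eq0 (negPf (fa_gen_neq0 _)) orbF.
by rewrite subr_eq0 => /eqP.
Qed.

Definition M2_alternative := @assocAlg_alternative k 'M[k]_2.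

(** The matrix units chosen satisfy [E00 E01 = E01] and [E01 E00 = 0], which separates the two
    orders of a product. *)
Definition to_M2 : algHom (F X2) (assocAlg 'M[k]_2) :=
  ev2 M2_alternative (delta_mx 0 0 : 'M[k]_2) (delta_mx 0 1 : 'M[k]_2).

Lemma to_M2_mul (p q : F X2) :
  to_M2 (amul p q) = (to_M2 p : 'M[k]_2) *m to_M2 q.
Proof. exact: algHom_mul. Qed.

Lemma to_M2_ga : to_M2 ga = delta_mx 0 0 :> 'M[k]_2.
Proof. by rewrite /to_M2 ev2a. Qed.
Lemma to_M2_gb : to_M2 gb = delta_mx 0 1 :> 'M[k]_2.
Proof. by rewrite /to_M2 ev2b. Qed.

Lemma noncommutative_products (c d : k) :
  c *: amul ga gb = d *: amul gb ga -> c = 0.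
Proof.
move/(congr1 to_M2); rewrite !linearZ /= !to_M2_mul to_M2_ga to_M2_gb.
rewrite mul_delta_mx mul_delta_mx_0 // => /(congr1 (fun M : 'M[k]_2 => M 0 1)).
by rewrite !mxE /= mulr1 mulr0.
Qed.

(** The hypothesis is the left alternative law for the product [al xy + be yx]. In the matrix model
    its [(0,1)] entry reads [(al + be) al = al al]. *)
Lemma alternative_combination (al be : k) :
    (al + be) *: (al *: amul (amul ga ga) gb + be *: amul gb (amul ga ga))
    = al *: amul ga (al *: amul ga gb + be *: amul gb ga)
      + be *: amul (al *: amul ga gb + be *: amul gb ga) ga ->
  al = 0 \/ be = 0.
Proof.
rewrite !(amulDl, amulDr, amulZl, amulZr).
move/(congr1 to_M2); rewrite !(linearZ, linearD) /=.
rewrite !to_M2_mul to_M2_ga to_M2_gb.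
rewrite !(mul0mx, mulmx0, mul_delta_mx, mul_delta_mx_0) //.
move=> /(congr1 (fun M : 'M[k]_2 => M 0 1)); rewrite !mxE /=.
rewrite !(mulr0, mulr1, addr0) mulrDl => /eqP.
rewrite -subr_eq0 addrAC subrr add0r mulf_eq0.
by case/orP=> /eqP; [right|left].
Qed.

Definition natural (u : forall X, F X -> F X) : Prop :=
  forall X Y (f : algHom (F X) (F Y)) x, f (u X x) = u Y (f x).

(** A natural unary operation is substitution into the one-variable element [u X1 gx]. Substituting
    [p] into that element yields the generator, which forces it to be linear. *)
Lemma natural_invertible (u : forall X, F X -> F X) (p : F X1) :
    2%:R != 0 :> k -> natural u -> u X1 p = gx ->
  exists c, forall X x, u X x = c *: x.
Proof.
move=> two_neq0 un up.
have uE X x : u X x = ev1 (@free_alt X) x (u X1 gx) by rewrite un ev1E.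
rewrite uE in up.
have [c cE] := invertible_endo_linear two_neq0 X1_single up.
by exists c => X x; rewrite uE cE linearZ /= ev1E.
Qed.

Lemma mdeg_one_gt0 (V : Type) (m : monom V) : (0 < mdeg (fun=> 1%N) m)%N.
Proof. by elim: m => //= m IHm n IHn; rewrite addn_gt0 IHm. Qed.

Lemma mdeg_one_eq1 (V : Type) (m : monom V) :
  mdeg (fun=> 1%N) m = 1%N -> exists v, m = MVar v.
Proof.
case: m => [v _|m n /= h]; first by exists v.
by have := leq_add (mdeg_one_gt0 m) (mdeg_one_gt0 n); rewrite h.
Qed.

Lemma linear_part (s : seq (k * monom X2)) :
  exists al be,
    lincomb [seq t <- s | mdeg (fun=> 1%N) t.2 == 1%N] = al *: ga + be *: gb.
Proof.
rewrite /lincomb big_filter.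
apply: (big_ind (fun z => exists al be, z = al *: ga + be *: gb)).
- by exists 0, 0; rewrite !scale0r addr0.
- move=> _ _ [a [b ->]] [c [d ->]]; exists (a + c), (b + d).
  by rewrite !scalerDl addrACA.
case=> a m /= /eqP /mdeg_one_eq1 [v ->].
case: (X2_cases v) => ->; first by exists a, 0; rewrite scale0r addr0.
by exists 0, a; rewrite scale0r add0r.
Qed.

Definition deg1 (v : X2) : nat := v == i1.
Definition deg2 (v : X2) : nat := v == i2.

Lemma mdeg_split (m : monom X2) :
  mdeg (fun=> 1%N) m = (mdeg deg1 m + mdeg deg2 m)%N.
Proof.
elim: m => [v|m IHm n IHn] /=; first by case: (X2_cases v) => ->.
by rewrite IHm IHn addnACA.
Qed.

(** A word of degree one in each of the two letters has total degree two, hence is one of the two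
    products of these letters. *)
Lemma bilinear_part (s : seq (k * monom X2)) :
  exists al be,
    lincomb [seq t <- [seq t <- s | mdeg deg1 t.2 == 1%N]
               | mdeg deg2 t.2 == 1%N]
    = al *: amul ga gb + be *: amul gb ga.
Proof.
rewrite /lincomb big_filter big_filter_cond.
apply: (big_ind (fun z =>
  exists al be, z = al *: amul ga gb + be *: amul gb ga)).
- by exists 0, 0; rewrite !scale0r addr0.
- move=> _ _ [a [b ->]] [c [d ->]]; exists (a + c), (b + d).
  by rewrite !scalerDl addrACA.
case=> a m /= /andP[/eqP h1 /eqP h2].
have := mdeg_split m; rewrite h1 h2.
case: m h1 h2 => [//|m n] /= h1 h2 h.
have [m1 n1] : mdeg (fun=> 1%N) m = 1%N /\ mdeg (fun=> 1%N) n = 1%N.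
  move: (mdeg_one_gt0 m) (mdeg_one_gt0 n) h.
  by case: (mdeg _ m) => [|[|i]] //; case: (mdeg _ n) => [|[|j]] //;
    rewrite !addSn !addnS.
have [v mE] := mdeg_one_eq1 m1; have [w nE] := mdeg_one_eq1 n1.
move: h1 h2; rewrite {h m1 n1}mE {}nE /=.
case: (X2_cases v) => ->; case: (X2_cases w) => -> //= _ _.
  by exists a, 0; rewrite scale0r addr0.
by exists 0, a; rewrite scale0r add0r.
Qed.

End Words.

(** * Automorphisms given by semilinear maps, and uniqueness of their type *)

Section SemilinearInner.
Variable k : fieldType.
Hypothesis two_neq0 : 2%:R != 0 :> k.
Local Notation F X := (freeAltOn k X).
Local Notation Aut := (autCat (Theta0 k)).

Definition act (U : functor (Theta0 k) (Theta0 k)) (X Y : {fset nat})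
  (f : algHom (F X) (F Y)) : algHom (F (U X)) (F (U Y)) := @fmap _ _ U X Y f.

Lemma act_comp (U : functor (Theta0 k) (Theta0 k)) (X Y Z : {fset nat})
    (g : algHom (F Y) (F Z)) (f : algHom (F X) (F Y)) :
  act U (comp_algHom g f) = comp_algHom (act U g) (act U f).
Proof. exact: (@fmapM _ _ U X Y Z g f). Qed.

(* [U f = s f s^-1] for a natural family [s] of [phi]-semilinear bijections,
   reversing products when [e]; for [phi = 1] and [e = false] this says that
   [U] is inner. *)
Definition semi_inner (U : Aut) (phi : fieldAut k) (e : bool) : Prop :=
  exists s : forall X : {fset nat}, F X -> F (U X),
  [/\ forall X, bijective (s X),
      forall X, {morph s X : x y / x + y},
      forall X a x, s X (a *: x) = phi a *: s X x,
      forall X x y, s X (amul x y)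
        = if e then amul (s X y) (s X x) else amul (s X x) (s X y)
    & forall X Y (f : algHom (F X) (F Y)) x, act U f (s X x) = s Y (f x)].

Lemma semi_inner1 (U : Aut) : inner U <-> semi_inner U 1%g false.
Proof.
split=> [[s [sI sN]]|[s [sB sD sZ sM sN]]].
  exists (fun X => (s X : algHom (F X) (F (U X)))); split.
  - move=> X; have [t [ts st]] := sI X.
    exists (t : algHom (F (U X)) (F X)) => x.
      by have := congr1 (fun h : algHom (F X) (F X) => h x) ts.
    by have := congr1 (fun h : algHom (F (U X)) (F (U X)) => h x) st.
  - by move=> X x y; exact: linearD.
  - by move=> X a x; exact: linearZ.
  - by move=> X x y; exact: algHom_mul.
  - move=> X Y f x.
    by have := congr1 (fun h : algHom (F X) (F (U Y)) => h x) (sN X Y f).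
have sL X : linear (s X) by move=> a x y; rewrite sD sZ.
have tE X : exists t : F (U X) -> F X, cancel (s X) t /\ cancel t (s X).
  by have [t st ts] := sB X; exists t.
pose t X := projT1 (cid (tE X)).
have st X : cancel (s X) (t X) by rewrite /t; case: cid => ? [].
have ts X : cancel (t X) (s X) by rewrite /t; case: cid => ? [].
have tL X : linear (t X).
  by move=> a x y; apply: (can_inj (st X)); rewrite sL !ts.
have tM X : {morph t X : x y / amul x y}.
  by move=> x y; apply: (can_inj (st X)); rewrite sM !ts.
exists (fun X => AlgHom (sL X) (sM X)); split=> [X|X Y f].
  by exists (AlgHom (tL X) (@tM X)); split; apply: algHom_eq => x /=;
    [exact: st|exact: ts].
by apply: algHom_eq => x; exact: sN.
Qed.

Lemma semi_innerM (U U' : Aut) (phi phi' : fieldAut k) (e e' : bool) :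
    semi_inner U phi e -> semi_inner U' phi' e' ->
  semi_inner (U * U')%g (phi * phi')%g (e (+) e').
Proof.
case=> s [sB sD sZ sM sN] [s' [sB' sD' sZ' sM' sN']].
exists (fun X x => s (U' X) (s' X x)); split.
- by move=> X; apply: bij_comp; [exact: sB|exact: sB'].
- by move=> X x y; rewrite sD' sD.
- by move=> X a x; rewrite sZ' sZ.
- by move=> X x y; rewrite sM'; case: e' {sM'}; rewrite sM; case: e {sM}.
- by move=> X Y f x; rewrite -sN' -sN.
Qed.

Lemma semi_inner_unique (U : Aut) (phi phi' : fieldAut k) (e e' : bool) :
    semi_inner U phi e -> semi_inner U phi' e' -> phi = phi' /\ e = e'.
Proof.
case=> s [sB sD sZ sM sN] [s' [sB' sD' sZ' sM' sN']].
have tE X : exists t : F (U X) -> F X, cancel (s' X) t /\ cancel t (s' X).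
  by have [t st ts] := sB' X; exists t.
pose t X := projT1 (cid (tE X)).
have st X : cancel (s' X) (t X) by rewrite /t; case: cid => ? [].
have ts X : cancel (t X) (s' X) by rewrite /t; case: cid => ? [].
(* The two families differ by the natural bijection [s'^-1 s], which is multiplication by a nonzero
   scalar [c]; this scalar cannot alter the field automorphism or the order of products. *)
have un : natural (fun X x => t X (s X x)).
  by move=> X Y f x; apply: (can_inj (st Y)); rewrite -sN' !ts sN.
have [q _ sq] := sB X1.
have uq : t X1 (s X1 (q (s' X1 (gx k)))) = gx k by rewrite sq st.
have [c cE] := natural_invertible two_neq0 un uq.
have sE X x : s X x = s' X (c *: x) by rewrite -cE ts.
have c0 : c != 0.
  apply/eqP => c0; move: uq; rewrite cE c0 scale0r => /esym/eqP.
  by rewrite (negPf (fa_gen_neq0 _ _)).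
split.
  apply: fieldAut_eq => a; have := sZ X1 a (gx k).
  rewrite !sE scalerA mulrC -scalerA sZ' -!sE => /eqP.
  rewrite -subr_eq0 -scalerBl.
  have s0 X : s X 0 = 0 by apply: (addrI (s X 0)); rewrite -sD !addr0.
  rewrite scaler_eq0 => /orP[|/eqP h]; first by rewrite subr_eq0 eq_sym => /eqP.
  have /eqP := bij_inj (sB X1) (etrans h (esym (s0 X1))).
  by rewrite (negPf (fa_gen_neq0 _ _)).
apply/eqP/negPn/negP => ee'.
(* If exactly one family reverses products, [c xy] and [c^2 yx] have the same image under [s']. *)
have : s X2 (amul (ga k) (gb k)) = s' X2 (amul (c *: gb k) (c *: ga k)).
  by rewrite sM sM' !sE; case: (e) (e') ee' => [] [].
rewrite sE amulZl amulZr => /(bij_inj (sB' X2)).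
by rewrite scalerA => /noncommutative_products /eqP; rewrite (negPf c0).
Qed.

End SemilinearInner.

(** * Action of an automorphism on elements of free algebras *)

Section Representation.
Variables (k : fieldType) (U : autCat (Theta0 k)).
Hypothesis two_neq0 : 2%:R != 0 :> k.
Local Notation F X := (freeAltOn k X).

Lemma act_inj (X Y : {fset nat}) : injective (@act k U X Y).
Proof. exact: (invertible_functor_inj (aut_invertible U)). Qed.

Lemma act_surj (X Y : {fset nat}) (h : algHom (F (U X)) (F (U Y))) :
  exists f, @act k U X Y f = h.
Proof. exact: (@invertible_functor_surj _ _ U X Y h (aut_invertible U)). Qed.

(* Among the free algebras, those of rank one are the ones with exactly two
   idempotent endomorphisms, and [U] preserves this property. *)
Lemma rank_one_image : exists y : U X1, forall v : U X1, v = y.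
Proof.
have idem (h : algHom (F (U X1)) (F (U X1))) : comp_algHom h h = h ->
    h = act U (zero_algHom (F X1) (F X1)) \/ h = id_algHom (F (U X1)).
  have [f <-] := act_surj h; rewrite -act_comp => /act_inj ff.
  have fE p : f (f p) = f p by rewrite -[in RHS]ff.
  have [-> | ->] := idempotent_endo two_neq0 X1_single fE; first by left.
  by right; exact: (@fmap1 _ _ U X1).
have ne0 : act U (zero_algHom (F X1) (F X1)) <> id_algHom (F (U X1)).
  rewrite -(_ : act U (id_algHom (F X1)) = id_algHom (F (U X1))); last first.
    exact: (@fmap1 _ _ U X1).
  move=> /act_inj /(congr1 (fun h : algHom (F X1) (F X1) => h (gx k))).
  move=> /esym/eqP.
  by rewrite (negPf (fa_gen_neq0 _ _)).
(* With no generator at all, any two endomorphisms would coincide, against [ne0]. *)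
have [[y]|noy] := pselect (exists y : U X1, True); last first.
  case: ne0; apply: freeAlt_hom_ext => v; case: noy; by exists v.
move=> _; exists y.
(* The retraction that keeps [y] and kills every other generator is a nonzero idempotent, hence the
   identity; so no other generator exists. *)
pose e := fext (@free_alt k (U X1))
  (fun v : U X1 => if v == y then fa_gen k v else 0).
have eE v : e (fa_gen k v) = if v == y then fa_gen k v else 0 by exact: fextE.
have ey : e (fa_gen k y) = fa_gen k y by rewrite eE eqxx.
have ee : comp_algHom e e = e.
  apply: freeAlt_hom_ext => v /=; rewrite eE; case: ifP => [|_].
    by move=> vy; rewrite eE vy.
  exact: linear0.
pose z := zero_algHom (F (U X1)) (F (U X1)).
have zz : comp_algHom z z = z by apply: algHom_eq.
have y0 := fa_gen_neq0 k y.
have zE : act U (zero_algHom (F X1) (F X1)) = z.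
  have [-> //|/(congr1 (fun h : algHom _ _ => h (fa_gen k y)))] := idem _ zz.
  by move=> /= /esym /eqP; rewrite (negPf y0).
have [|eid] := idem _ ee.
  rewrite zE => /(congr1 (fun h : algHom _ _ => h (fa_gen k y))).
  by rewrite ey => /eqP; rewrite (negPf y0).
move=> v; apply/eqP/negPn/negP => vy.
have := eE v; rewrite (negPf vy) eid => /eqP.
by rewrite (negPf (fa_gen_neq0 k v)).
Qed.

(* Elements of [F X] are homomorphisms [F X1 -> F X], so [U] acts on them. *)
Lemma element_map :
  exists (y : U X1) (s : forall X : {fset nat}, F X -> F (U X)),
  [/\ forall v, v = y, s X1 (gx k) = fa_gen k y,
      forall X, bijective (s X)
    & forall X Y (f : algHom (F X) (F Y)) x, act U f (s X x) = s Y (f x)].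
Proof.
have [y y1] := rank_one_image.
pose s (X : {fset nat}) (a : F X) : F (U X) :=
  act U (ev1 (@free_alt k X) a) (fa_gen k y).
have ev1f (X Y : {fset nat}) (f : algHom (F X) (F Y)) x :
    comp_algHom f (ev1 (@free_alt k X) x) = ev1 (@free_alt k Y) (f x).
  apply: freeAlt_hom_ext => v; rewrite (X1_single v) /=.
  by rewrite [ev1 _ _ _ in LHS]ev1E [RHS]ev1E.
have s_inj X : injective (s X).
  move=> a b ab; have : ev1 (@free_alt k X) a = ev1 (@free_alt k X) b.
    by apply: act_inj; apply: freeAlt_hom_ext => v; rewrite (y1 v).
  by move/(congr1 (fun h : algHom _ _ => h (gx k))); rewrite !ev1E.
exists y, s; split=> // [|X|X Y f x].
- rewrite /s (_ : ev1 _ _ = id_algHom (F X1)).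
    by rewrite (_ : act U _ = id_algHom _) //; exact: (@fmap1 _ _ U X1).
  by apply: freeAlt_hom_ext => v; rewrite (X1_single v); exact: ev1E.
(* Fullness of [U] lifts the homomorphism sending [y] to [b]; the preimage is the value of the lift
   at the generator. *)
- have s_surj b : exists a, s X a = b.
    have [f fE] := act_surj (fext (@free_alt k (U X)) (fun _ : U X1 => b)).
    exists (f (gx k)); rewrite /s (_ : ev1 _ _ = f); last first.
      by apply: freeAlt_hom_ext => v; rewrite (X1_single v); exact: ev1E.
    by rewrite fE fextE.
  exists (fun b => projT1 (cid (s_surj b))) => [a|b]; last by case: cid.
  by apply: s_inj; case: cid.
by rewrite /s -ev1f act_comp.
Qed.

End Representation.

(** * Transport of the algebra operations along the element bijections *)

Section Transport.
Variables (k : fieldType) (U : autCat (Theta0 k)).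
Hypothesis char0 : [pchar k] =i pred0.
Local Notation F X := (freeAltOn k X).
Variables (y : U X1) (s : forall X : {fset nat}, F X -> F (U X)).
Variable r : forall X : {fset nat}, F (U X) -> F X.
Hypothesis y1 : forall v, v = y.
Hypothesis s_gx : s (gx k) = fa_gen k y.
Hypothesis sK : forall X, cancel (@s X) (@r X).
Hypothesis rK : forall X, cancel (@r X) (@s X).
Hypothesis s_nat : forall X Y (f : algHom (F X) (F Y)) x,
  act U f (s x) = s (f x).

Lemma natr_inj_char0 : injective (fun n : nat => n%:R : k).
Proof.
move=> m n; wlog mn : m n / (m <= n)%N => [hw|] h.
  by case/orP: (leq_total m n) => ?; [exact: hw|apply/esym; exact: hw].
apply/eqP; rewrite eqn_leq mn /= -subn_eq0.
by rewrite -(GRing.pcharf0P k).1 // natrB // h subrr.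
Qed.

Lemma two_neq0_char0 : 2%:R != 0 :> k.
Proof. by rewrite (GRing.pcharf0P k).1. Qed.

Lemma r_nat (X Y : {fset nat}) (f : algHom (F X) (F Y)) x :
  f (r x) = r (act U f x).
Proof. by apply: (can_inj (@sK Y)); rewrite -s_nat !rK. Qed.

Lemma r0 (X : {fset nat}) : r (0 : F (U X)) = 0.
Proof. by have := r_nat (zero_algHom (F X) (F X)) 0; rewrite linear0. Qed.

Lemma s0 (X : {fset nat}) : s (0 : F X) = 0.
Proof. by rewrite -[in LHS](r0 X) rK. Qed.

Lemma transported_scale (a : k) :
  exists c, forall (X : {fset nat}) (x : F X), r (a *: s x) = c *: x.
Proof.
have [->|a0] := eqVneq a 0.
  by exists 0 => X x; rewrite !scale0r r0.
apply: (@natural_invertible _ (fun X x => r (a *: s x)) (r (a^-1 *: s (gx k)))).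
- exact: two_neq0_char0.
- by move=> X Y f x; rewrite r_nat linearZ /= s_nat.
- by rewrite rK scalerA mulfV // scale1r sK.
Qed.

(** The scalar action on the target, pulled back to the source. Thus [s] is semilinear for the
    inverse of [psi]. *)
Definition psi (a : k) : k := projT1 (cid (transported_scale a)).

Lemma psiE (a : k) (X : {fset nat}) (x : F X) : r (a *: s x) = psi a *: x.
Proof. by rewrite /psi; case: cid. Qed.

Lemma s_psi (a : k) (X : {fset nat}) (x : F X) : s (psi a *: x) = a *: s x.
Proof. by rewrite -psiE rK. Qed.

Lemma psiM a b : psi (a * b) = psi a * psi b.
Proof.
apply: gx_scale_inj; rewrite -[RHS]scalerA -!psiE.
by rewrite -scalerA rK.
Qed.

Lemma psi1 : psi 1 = 1.
Proof. by apply: gx_scale_inj; rewrite -psiE !scale1r sK. Qed.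

Lemma psi_inj : injective psi.
Proof.
move=> a b ab; have /(can_inj (@rK X1)) : r (a *: s (gx k)) = r (b *: s (gx k)).
  by rewrite !psiE ab.
move/eqP; rewrite -subr_eq0 -scalerBl scaler_eq0 s_gx.
by rewrite (negPf (fa_gen_neq0 _ _)) orbF subr_eq0 => /eqP.
Qed.

Lemma psiX a n : psi (a ^+ n) = psi a ^+ n.
Proof. by elim: n => [|n IH]; rewrite ?expr0 ?psi1 // !exprS psiM IH. Qed.

(** Characteristic zero enters here: the dilation by 2 has distinct eigenvalues in distinct
    degrees. *)
Lemma two_pow_inj i : (2%:R : k) ^+ i = 2%:R ^+ 1 -> i = 1%N.
Proof.
rewrite -!natrX => /natr_inj_char0 /eqP; rewrite eqn_exp2l // => /eqP; exact.
Qed.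

Lemma rD_nat (X Y : {fset nat}) (f : algHom (F X) (F Y)) a b :
  f (r (s a + s b)) = r (s (f a) + s (f b)).
Proof. by rewrite r_nat linearD /= !s_nat. Qed.

Lemma rM_nat (X Y : {fset nat}) (f : algHom (F X) (F Y)) a b :
  f (r (amul (s a) (s b))) = r (amul (s (f a)) (s (f b))).
Proof. by rewrite r_nat algHom_mul !s_nat. Qed.

(** The transported sum is a two-variable element [w]. It is an eigenvector of a dilation for the
    eigenvalue of degree one, hence linear, and the neutrality of 0 fixes both coefficients as 1. *)
Lemma transported_add (X : {fset nat}) (a b : F X) : r (s a + s b) = a + b.
Proof.
pose w := r (s (ga k) + s (gb k)).
have wE (Y : {fset nat}) (c d : F Y) :
    r (s c + s d) = ev2 (@free_alt k Y) c d w.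
  by rewrite /w rD_nat ev2a ev2b.
(* Additivity of [psi] is derived from this lemma, so [psi 2] is not yet known to be 2. Its powers
   are still distinct, [psi] being injective and multiplicative. *)
pose mu := psi 2%:R.
pose D := ev2 (@free_alt k X2) (mu *: ga k) (mu *: gb k).
have Dw : D w = mu ^+ 1 *: w.
  by rewrite expr1 -wE !s_psi -scalerDr -psiE /w rK.
have Dg v : D (fa_gen k v) = mu ^+ 1 *: fa_gen k v.
  by rewrite expr1; case: (X2_cases v) => ->; [exact: ev2a|exact: ev2b].
have mu1 i : mu ^+ i = mu ^+ 1 -> i = 1%N.
  by rewrite -!psiX => /psi_inj /two_pow_inj.
have [t wt] := freeAlt_span w.
rewrite wt in Dw; have := dilation_homogeneous (d := fun=> 1%N) Dg mu1 Dw.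
rewrite -wt; have [al [be ->]] := linear_part t => wab.
have rab (Y : {fset nat}) (c d : F Y) : r (s c + s d) = al *: c + be *: d.
  by rewrite wE wab linearD !linearZ /= ev2a ev2b.
have al1 : al = 1.
  apply: gx_scale_inj; have := rab X1 (gx k) 0.
  by rewrite s0 addr0 sK scaler0 addr0 scale1r.
have be1 : be = 1.
  apply: gx_scale_inj; have := rab X1 0 (gx k).
  by rewrite s0 add0r sK scaler0 add0r scale1r.
by rewrite rab al1 be1 !scale1r.
Qed.

Lemma sD (X : {fset nat}) : {morph @s X : a b / a + b}.
Proof. by move=> a b; rewrite -transported_add rK. Qed.

Lemma rD (X : {fset nat}) : {morph @r X : a b / a + b}.
Proof. by move=> a b; rewrite -{1}(rK a) -{1}(rK b) transported_add. Qed.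

Lemma psiD a b : psi (a + b) = psi a + psi b.
Proof.
by apply: gx_scale_inj; rewrite -psiE scalerDl rD !psiE scalerDl.
Qed.

Lemma s_two (X : {fset nat}) (x : F X) : s (2%:R *: x) = 2%:R *: s x.
Proof. by rewrite !scaler_nat !mulr2n sD. Qed.

Lemma r_two (X : {fset nat}) (x : F (U X)) : r (2%:R *: x) = 2%:R *: r x.
Proof. by rewrite !scaler_nat !mulr2n rD. Qed.

(** Since [s] is now additive, it commutes with doubling. Doubling one variable at a time shows that
    the transported product has degree one in each. *)
Lemma transported_mul_bilinear :
  exists al be, forall (X : {fset nat}) (a b : F X),
    r (amul (s a) (s b)) = al *: amul a b + be *: amul b a.
Proof.
pose w := r (amul (s (ga k)) (s (gb k))).
have wE (Y : {fset nat}) (c d : F Y) :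
    r (amul (s c) (s d)) = ev2 (@free_alt k Y) c d w.
  by rewrite /w rM_nat ev2a ev2b.
pose D1 := ev2 (@free_alt k X2) (2%:R *: ga k) (gb k).
pose D2 := ev2 (@free_alt k X2) (ga k) (2%:R *: gb k).
have D1w : D1 w = 2%:R ^+ 1 *: w.
  by rewrite expr1 -wE s_two amulZl r_two.
have D2w : D2 w = 2%:R ^+ 1 *: w.
  by rewrite expr1 -wE s_two amulZr r_two.
have D1g v : D1 (fa_gen k v) = 2%:R ^+ deg1 v *: fa_gen k v.
  case: (X2_cases v) => ->; first exact: ev2a.
  by rewrite expr0 scale1r; exact: ev2b.
have D2g v : D2 (fa_gen k v) = 2%:R ^+ deg2 v *: fa_gen k v.
  case: (X2_cases v) => ->; last exact: ev2b.
  by rewrite expr0 scale1r; exact: ev2a.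
have [t wt] := freeAlt_span w.
have w1 := wt; rewrite wt in D1w.
rewrite (dilation_homogeneous D1g two_pow_inj D1w) in w1.
have w2 := w1; rewrite w1 in D2w.
rewrite (dilation_homogeneous D2g two_pow_inj D2w) in w2.
have [al [be wab]] := bilinear_part t; exists al, be => X a b.
by rewrite wE w2 wab linearD !linearZ /= !algHom_mul ev2a ev2b.
Qed.

Lemma transported_mul :
  exists c e, c != 0 /\ forall (X : {fset nat}) (a b : F X),
    r (amul (s a) (s b)) = c *: (if e then amul b a else amul a b).
Proof.
have [al [be mE]] := transported_mul_bilinear.
(* Otherwise the square of the generator [y] would vanish, which its image ['X^2] in the polynomials
   forbids. *)
have nz : al != 0 \/ be != 0.
  have [al0|] := eqVneq al 0; last by left.
  have [be0|] := eqVneq be 0; last by right.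
  have := mE X1 (gx k) (gx k); rewrite al0 be0 !scale0r addr0 -[RHS]r0.
  move/(can_inj (@rK X1)); rewrite s_gx => /(congr1 (to_poly k (U X1))) /eqP.
  by rewrite to_poly_mul to_poly_gen linear0 mulf_eq0 orbb polyX_eq0.
(* The left alternative law of the target, written for the transported product. *)
have : r (amul (s (r (amul (s (ga k)) (s (ga k))))) (s (gb k)))
    = r (amul (s (ga k)) (s (r (amul (s (ga k)) (s (gb k)))))).
  by rewrite !rK; congr (r _); case: (free_alt (s (ga k)) (s (gb k))).
rewrite !mE -scalerDl amulZl amulZr.
rewrite [be *: ((al + be) *: _)]scalerA [be * _]mulrC -scalerA.
rewrite [al *: ((al + be) *: _)]scalerA [al * _]mulrC.
rewrite -[in LHS]scalerA -scalerDr.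
case/alternative_combination => [al0|be0].
  exists be, true; split=> [|X a b]; first by case: nz => //; rewrite al0 eqxx.
  by rewrite mE al0 scale0r add0r.
exists al, false; split=> [|X a b]; first by case: nz => //; rewrite be0 eqxx.
by rewrite mE be0 scale0r addr0.
Qed.

Lemma psi_surj b : exists a, psi a = b.
Proof.
have [c [e [_ mE]]] := transported_mul.
(* Products have no linear term on either side, so [r] acts on linear coefficients through [psi]. At
   [s (b *: gx k)] this exhibits [b] as a value of [psi]. *)
have h (p : F (U X1)) :
    (to_poly k X1 (r p) : {poly k})`_1
    = psi ((to_poly k (U X1) p : {poly k})`_1).
  elim/freeAlt_ind: p.
  - move=> v; rewrite (y1 v) -s_gx sK s_gx !to_poly_gen coefX.
    exact: (esym psi1).
  - rewrite r0 !linear0 !coef0; apply: gx_scale_inj.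
    by rewrite -psiE !scale0r r0.
  - by move=> p q hp hq; rewrite rD !linearD !coefD psiD hp hq.
  - move=> a p hp; rewrite -{1}(rK p) psiE !linearZ /= !coefZ psiM.
    by rewrite hp.
  - move=> p q _ _; rewrite -{1}(rK p) -{1}(rK q) mE linearZ coefZ.
    rewrite (to_poly_coef1_mul (y1) p q).
    transitivity (0 : k); last first.
      by apply: gx_scale_inj; rewrite -psiE !scale0r r0.
    by case: e {mE}; rewrite (to_poly_coef1_mul X1_single) mulr0.
exists (to_poly k (U X1) (s (b *: gx k)) : {poly k})`_1.
by rewrite -h sK linearZ /= to_poly_gx coefZ coefX mulr1.
Qed.

Lemma psi_zmod : zmod_morphism psi.
Proof.
move=> a b; apply: (addIr (psi b)).
by rewrite -psiD !subrK.
Qed.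

Lemma psi_monoid : monoid_morphism psi.
Proof. by split; [exact: psi1|exact: psiM]. Qed.

Lemma psi_bij : bijective psi.
Proof.
exists (fun b => projT1 (cid (psi_surj b))) => [a|b]; last by case: cid.
by apply: psi_inj; case: cid.
Qed.

HB.instance Definition _ := GRing.isZmodMorphism.Build k k psi psi_zmod.
HB.instance Definition _ := GRing.isMonoidMorphism.Build k k psi psi_monoid.

Definition psi_aut : fieldAut k :=
  FieldAut (psi_bij : bijective (psi : {rmorphism k -> k})).

(* If [s a s b = s (c ab)] then [a |-> s (c^-1 a)] is multiplicative. *)
Lemma transport_semi_inner : exists e, semi_inner U (psi_aut^-1)%g e.
Proof.
have [c [e [c0 mE]]] := transported_mul.
have sM (X : {fset nat}) (a b : F X) :
    amul (s (c^-1 *: a)) (s (c^-1 *: b))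
    = s (c^-1 *: if e then amul b a else amul a b).
  rewrite -[LHS]rK mE; congr (s _); case: e {mE};
  by rewrite amulZl amulZr !scalerA mulrA mulfV // mul1r.
exists e, (fun X x => s (c^-1 *: x)); split.
- move=> X; exists (fun x => c *: r x) => x.
    by rewrite sK scalerA mulfV // scale1r.
  by rewrite scalerA mulVf // scale1r rK.
- by move=> X x z; rewrite scalerDr sD.
- move=> X a x; rewrite scalerA mulrC -scalerA -s_psi; congr (s (_ *: _)).
  exact: (esym (faut_invKV psi_aut a)).
- by move=> X x z; case: e sM {mE} => ->.
- by move=> X Y f x; rewrite s_nat linearZ.
Qed.

End Transport.

Lemma semi_inner_exists (k : fieldType) (U : autCat (Theta0 k)) :
  [pchar k] =i pred0 -> exists phi e, semi_inner U phi e.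
Proof.
move=> char0.
have [y [s [y1 s_gx sB sN]]] := element_map U (two_neq0_char0 char0).
have rE X : exists r, cancel (s X) r /\ cancel r (s X).
  by have [r sr rs] := sB X; exists r.
pose r X := projT1 (cid (rE X)).
have sK X : cancel (s X) (r X) by rewrite /r; case: cid => ? [].
have rK X : cancel (r X) (s X) by rewrite /r; case: cid => ? [].
have [e he] := transport_semi_inner char0 y1 s_gx sK rK sN.
by eexists; exists e; exact: he.
Qed.

(** * Realisation of every type by conjugation *)

Section TwistMap.
Variable k : fieldType.
Local Notation F X := (freeAltOn k X).

(** The semilinear, possibly product-reversing map fixing the generators is obtained as an ordinary
    homomorphism into the twisted algebra, by the universal property. *)
Definition tw_hom (phi : fieldAut k) (e : bool) (X : {fset nat}) :
    algHom (F X) (twist phi e (F X)) :=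
  fext (@twist_alternative k phi e _ (@free_alt k X)) (fun v => fa_gen k v).
Definition tw phi e (X : {fset nat}) : F X -> F X := tw_hom phi e X.

Variable e : bool.
Implicit Types phi chi : fieldAut k.

Lemma tw_gen phi (X : {fset nat}) (v : X) :
  tw phi e (fa_gen k v : F X) = fa_gen k v.
Proof.
exact (fextE (@twist_alternative k phi e _ (@free_alt k X)) (@fa_gen k X) v).
Qed.

Lemma twD phi (X : {fset nat}) : {morph @tw phi e X : x y / x + y}.
Proof. by move=> x y; exact (linearD (tw_hom phi e X) x y). Qed.

Lemma tw0 phi (X : {fset nat}) : tw phi e (0 : F X) = 0.
Proof. exact (linear0 (tw_hom phi e X)). Qed.

Lemma twZ phi (X : {fset nat}) a (x : F X) :
  tw phi e (a *: x) = phi a *: tw phi e x.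
Proof. exact (linearZ_LR (tw_hom phi e X) a x). Qed.

Lemma twM phi (X : {fset nat}) (x y : F X) :
  tw phi e (amul x y) =
  if e then amul (tw phi e y) (tw phi e x) else amul (tw phi e x) (tw phi e y).
Proof. exact (algHom_mul (tw_hom phi e X) x y). Qed.

End TwistMap.

Section Conjugation.
Variables (k : fieldType) (e : bool).
Local Notation F X := (freeAltOn k X).
Implicit Types phi chi : fieldAut k.

Lemma twK phi chi (X : {fset nat}) :
  cancel phi chi -> cancel (@tw k phi e X) (@tw k chi e X).
Proof.
move=> K; elim/freeAlt_ind.
- by move=> v; rewrite !tw_gen.
- by rewrite !tw0.
- by move=> x y hx hy; rewrite !twD hx hy.
- by move=> a x hx; rewrite !twZ K hx.
- by move=> x y hx hy; rewrite !twM; case: (e) hx hy => hx hy;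
  rewrite twM hx hy.
Qed.

Lemma autVK phi : cancel phi (phi^-1)%g.
Proof. exact: faut_invK. Qed.
Lemma autKV phi : cancel (phi^-1)%g phi.
Proof. exact: faut_invKV. Qed.

Section ConjugateHom.
Variables (phi : fieldAut k) (X Y : {fset nat}) (f : algHom (F X) (F Y)).

(** The two twists of scalars cancel, and so do the two reversals of products, so this is again a
    homomorphism. *)
Definition conj_fun (x : F X) : F Y := tw phi e (f (tw (phi^-1)%g e x)).

Lemma conj_linear : linear conj_fun.
Proof.
by move=> a x y; rewrite /conj_fun twD twZ linearD linearZ /= twD twZ autKV.
Qed.

Lemma conj_mul : {morph conj_fun : x y / amul x y}.
Proof.
move=> x y; rewrite /conj_fun twM; case: (e);
by rewrite algHom_mul twM.
Qed.

Definition conj_hom : algHom (F X) (F Y) := AlgHom conj_linear conj_mul.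

End ConjugateHom.

Lemma conj_hom1 phi (X : {fset nat}) :
  conj_hom phi (id_algHom (F X)) = id_algHom (F X).
Proof. by apply: algHom_eq => x; exact: (twK (@autKV phi)). Qed.

Lemma conj_hom_comp phi (X Y Z : {fset nat}) (g : algHom (F Y) (F Z))
    (f : algHom (F X) (F Y)) :
  conj_hom phi (comp_algHom g f)
  = comp_algHom (conj_hom phi g) (conj_hom phi f).
Proof.
by apply: algHom_eq => x; rewrite /= /conj_fun (twK (@autVK phi)).
Qed.

Definition conj_functor phi : functor (Theta0 k) (Theta0 k) :=
  @Functor (Theta0 k) (Theta0 k) (fun X => X)
    (fun X Y f => conj_hom phi f) (@conj_hom1 phi) (@conj_hom_comp phi).

Lemma conj_homK phi chi (X Y : {fset nat}) (f : algHom (F X) (F Y)) :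
  cancel phi chi -> conj_hom chi (conj_hom phi f) = f.
Proof.
move=> K; apply: algHom_eq => x; rewrite /= /conj_fun.
rewrite (twK K) (twK (chi := (phi^-1)%g)) // => a.
by rewrite -{1}[a]K !autVK.
Qed.

Lemma conj_functorK phi chi :
  cancel phi chi ->
  compF (conj_functor chi) (conj_functor phi) = idF (Theta0 k).
Proof.
move=> K; apply: functor_eq.
apply: functional_extensionality_dep => X.
apply: functional_extensionality_dep => Y.
by apply: funext => f; exact: conj_homK.
Qed.

Lemma conj_functor_invertible phi : invertible_functor (conj_functor phi).
Proof.
exists (conj_functor (phi^-1)%g).
by split; apply: conj_functorK; [exact: autVK|exact: autKV].
Qed.

Lemma semi_inner_conj phi :
  semi_inner (AutCat (conj_functor_invertible phi)) phi e.
Proof.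
exists (@tw k phi e); split.
- move=> X; exists (@tw k (phi^-1)%g e X); apply: twK.
    exact: autVK.
  exact: autKV.
- exact: twD.
- by move=> X a x; exact: twZ.
- by move=> X x y; exact: twM.
- by move=> X Y f x; rewrite /act /= /conj_fun (twK (@autVK phi)).
Qed.

End Conjugation.

(** * The symmetric group on two elements as a group of signs *)

Section SymmetricGroup.

Definition sgn (e : bool) : 'S_2 := if e then tperm 0 1 else 1%g.

Lemma sgnM e e' : sgn (e (+) e') = (sgn e * sgn e')%g.
Proof. by case: e; case: e'; rewrite /= ?mulg1 ?mul1g // tperm2. Qed.

Lemma odd_sgn e : sgn e = e :> bool.
Proof. by case: e; rewrite /= ?odd_perm1 // odd_tperm. Qed.

Lemma sgn_surj (s : 'S_2) : exists e, sgn e = s.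
Proof.
have inj : injective sgn.
  by move=> e e' /(congr1 (@odd_perm _)); rewrite !odd_sgn.
have := inj_card_onto inj; rewrite card_bool card_Sn => /(_ isT s).
by case/codomP => e ->; exists e.
Qed.

End SymmetricGroup.

(** * The isomorphism from the outer automorphism group *)

Section Classification.
Variable k : fieldType.
Hypothesis char0 : [pchar k] =i pred0.
Local Notation Aut := (autCat (Theta0 k)).
Local Notation Out := (quotientGroup (innerSubgroup (Theta0 k))).

Lemma semi_inner_type_ex (U : Aut) :
  exists p : fieldAut k * bool, semi_inner U p.1 p.2.
Proof. by have [phi [e h]] := semi_inner_exists U char0; exists (phi, e). Qed.

Definition semi_inner_type (U : Aut) : fieldAut k * bool :=
  projT1 (cid (semi_inner_type_ex U)).

Lemma semi_inner_typeP U :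
  semi_inner U (semi_inner_type U).1 (semi_inner_type U).2.
Proof. by rewrite /semi_inner_type; case: cid. Qed.

Lemma semi_inner_typeE U phi e :
  semi_inner U phi e -> semi_inner_type U = (phi, e).
Proof.
have two_neq0 := two_neq0_char0 char0.
move=> h; have [<- <-] := semi_inner_unique two_neq0 (semi_inner_typeP U) h.
by case: semi_inner_type.
Qed.

Definition out_type (U : Aut) : 'S_2 * fieldAut k :=
  (sgn (semi_inner_type U).2, (semi_inner_type U).1).

Lemma out_typeM U W : out_type (U * W)%g = (out_type U * out_type W)%g.
Proof.
have := semi_innerM (semi_inner_typeP U) (semi_inner_typeP W).
by move/semi_inner_typeE; rewrite /out_type => ->; rewrite /= sgnM.
Qed.

Lemma out_type_inner U : out_type U = 1%g <-> inner U.
Proof.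
split=> [[s1 p1]|/semi_inner1 /semi_inner_typeE h]; last by rewrite /out_type h.
apply/semi_inner1; rewrite -p1.
have <- : (semi_inner_type U).2 = false.
  by rewrite -[LHS]odd_sgn s1 odd_perm1.
exact: semi_inner_typeP.
Qed.

(** Well-definedness and injectivity on the quotient at once: the type is multiplicative with kernel
    the inner automorphisms. *)
Lemma out_type_coset U W :
  out_type U = out_type W <-> inner (U^-1 * W)%g.
Proof.
have typeV : (out_type U^-1 * out_type U = 1)%g.
  by rewrite -out_typeM mulVg; apply/out_type_inner; exact: inner1.
rewrite -out_type_inner out_typeM; split=> [<- //|h].
by apply: (mulgI (out_type (U^-1)%g)); rewrite h typeV.
Qed.

Definition out_iso (q : Out) : 'S_2 * fieldAut k := out_type (repr q).

Lemma out_isoE U : out_iso (\pi_Out U) = out_type U.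
Proof.
by apply/esym/out_type_coset; exact: (repr_coset (innerSubgroup _) U).
Qed.

Lemma out_isoM : {morph out_iso : p q / (p * q)%g}.
Proof.
move=> p q; rewrite -[p]reprK -[q]reprK [X in out_iso X]quo_mulE.
by rewrite !out_isoE out_typeM.
Qed.

HB.instance Definition _ :=
  isMultiplicative.Build Out ('S_2 * fieldAut k)%type out_iso out_isoM.

Lemma out_iso_bij : bijective out_iso.
Proof.
have inj : injective out_iso.
  move=> p q; rewrite -[p]reprK -[q]reprK !out_isoE => /out_type_coset h.
  exact/eq_coset.
have surj t : exists q, out_iso q = t.
  case: t => s phi; have [e <-] := sgn_surj s.
  (* Conjugation by the twist of type [(phi, e)] is an automorphism with the prescribed image. *)
  have := semi_inner_typeE (semi_inner_conj e phi).
  set U := AutCat _ => h; exists (\pi_Out U).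
  by rewrite out_isoE /out_type h.
exists (fun t => projT1 (cid (surj t))) => [q|t]; last by case: cid.
by apply: inj; case: cid.
Qed.

End Classification.

Theorem theorem4p2 (k : fieldType) (char0 : [pchar k]%R =i pred0) :
  isomorphic_groups
    (quotientGroup (innerSubgroup (Theta0 k)))
    ('S_2 * fieldAut k)%type.
Proof. by exists (out_iso char0); exact: out_iso_bij. Qed.
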